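(* For every $\Delta\in\mathbb N$ there exists a positive constant $C$ such that the following holds for every sufficiently large $d\in\mathbb N$. If $G$ is an $(n,d,\lambda)$-graph with $d/\lambda\ge C$, then the square $G^2$ contains a copy of every $n$-vertex tree with maximum degree at most $\Delta$.
   Context: An $(n,d,\lambda)$-graph is an $n$-vertex $d$-regular graph such that every eigenvalue of its adjacency matrix other than the largest one (which equals $d$) has absolute value at most $\lambda$. The square $G^2$ of a graph $G$ is the graph on $V(G)$ obtained from $G$ by adding an edge between every pair of vertices at distance $2$ in $G$. ''Sufficiently large $d$'' means: there exists $d_0=d_0(\Delta)$ such that the statement holds for all $d\ge d_0$ (with $C$ fixed). *)

(* Defs.v *)
From HB Require Import structures.
From mathcomp Require Import all_boot all_order all_algebra.
From mathcomp Require Import reals.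

Set Implicit Arguments.
Unset Strict Implicit.
Unset Printing Implicit Defensive.

Import Order.TTheory GRing.Theory Num.Theory.
Local Open Scope ring_scope.

Record sgraph := SGraph {
  vertex :> finType;
  adj : rel vertex;
  adj_sym : symmetric adj;
  adj_irr : irreflexive adj
}.

Definition degree (G : sgraph) (x : G) : nat := #|[set y | adj x y]|.

Definition max_degree (G : sgraph) : nat := (\max_(x : G) degree x)%N.

Definition regular (G : sgraph) (d : nat) : Prop := forall x : G, degree x = d.

Definition adj_mx (R : realType) (G : sgraph) : 'M[R]_#|G| :=
  \matrix_(i, j) (adj (enum_val i) (enum_val j))%:R.

(* The list of eigenvalues, repeated with multiplicity, in nonincreasing order.
   A symmetric real matrix always has exactly one such list. *)
Definition spectrum (R : realType) (n : nat) (A : 'M[R]_n) (s : seq R) : Prop :=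
  sorted >=%R s /\ char_poly A = \prod_(a <- s) ('X - a%:P).

(* Only one copy of the largest eigenvalue d is dropped: if d has multiplicity
   at least 2 (G disconnected), then lambda must be at least d. *)
Definition ndl_graph (R : realType) (n d : nat) (lambda : R) (G : sgraph) :
    Prop :=
  [/\ #|G| = n, regular G d &
      exists2 s : seq R, spectrum (adj_mx R G) s &
        forall a, a \in behead s -> `|a| <= lambda].

Definition has_walk (G : sgraph) (k : nat) (x y : G) : bool :=
  [exists p : k.-tuple G, path (@adj G) x p && (last x p == y)].

Definition at_distance (G : sgraph) (k : nat) (x y : G) : bool :=
  has_walk k x y && [forall j : 'I_k, ~~ has_walk j x y].

Definition square_adj (G : sgraph) : rel G :=
  fun x y => adj x y || at_distance 2 x y.

Lemma has_walk_sym (G : sgraph) (k : nat) (x y : G) :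
  has_walk k x y = has_walk k y x.
Proof.
suff H : forall u v : G, has_walk k u v -> has_walk k v u
  by apply/idP/idP; apply: H.
move=> u v /existsP[p /andP[Hp /eqP Hl]].
have sz : size (rev (belast u p)) == k by rewrite size_rev size_belast size_tuple.
apply/existsP; exists (Tuple sz) => /=; rewrite -Hl; apply/andP; split.
  rewrite rev_path; move: Hp; congr is_true.
  by apply: eq_path => a b; rewrite adj_sym.
by case: (p : seq G) => //= b q; rewrite rev_cons last_rcons.
Qed.

Lemma square_adj_sym (G : sgraph) : symmetric (@square_adj G).
Proof.
move=> x y; rewrite /square_adj /at_distance adj_sym has_walk_sym.
by congr (_ || (_ && _)); apply: eq_forallb => j; rewrite has_walk_sym.
Qed.

Lemma square_adj_irr (G : sgraph) : irreflexive (@square_adj G).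
Proof.
move=> x; rewrite /square_adj adj_irr /=; apply/negP => /andP[_ /forallP].
move=> /(_ ord0) /existsP; apply.
by exists [tuple] => /=.
Qed.

Definition square (G : sgraph) : sgraph :=
  SGraph (@square_adj_sym G) (@square_adj_irr G).

Definition connected (G : sgraph) : Prop :=
  (0 < #|G|)%N /\ forall x y : G, connect (@adj G) x y.

(* A sequence of two adjacent vertices is a ucycle, hence the length bound. *)
Definition acyclic (G : sgraph) : Prop :=
  forall c : seq G, (2 < size c)%N -> ~ ucycle (@adj G) c.

Definition is_tree (G : sgraph) : Prop := connected G /\ acyclic G.

(* H contains a copy of F as a (not necessarily induced) subgraph. *)
Definition contains_copy (H F : sgraph) : Prop :=
  exists2 f : F -> H, injective f & forall x y : F, adj x y -> adj (f x) (f y).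

(* Main.v *)
Require Import Defs.
From HB Require Import structures.
From mathcomp Require Import all_boot all_order all_algebra.
From mathcomp Require Import reals.
From mathcomp Require Import complex.
From mathcomp Require Import zify lra ring.

Set Implicit Arguments.
Unset Strict Implicit.
Unset Printing Implicit Defensive.

(** The eigenvalue condition gives [|N(X)| >= t^2 n |X| / (n + t^2 |X|)] with
    [t = d / lambda], hence large expansion of small sets, and an edge between
    any two sets of [m ~ n / t] vertices.

    The tree [T] is first replaced by a tree [Z] on the same vertices with
    [T] contained in [Z^2]: on many disjoint vertical paths of [T] the vertices
    are reordered in zigzag, which turns the path into a pendant path of [Z]
    that ends with a leaf.  It then suffices to find [Z] as a spanning tree of
    [G].  As the maximum degree is bounded, some constant [K] leaves about
    [n / K^s] candidates for a pendant path of length about [2 s], among which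
    a constant multiple of [m / g^s] are chosen for every scale [s], all
    disjoint; [g] is a constant much larger than [K].

    Trees are grown in [G] vertex by vertex in the manner of Friedman and
    Pippenger, keeping the unused vertices expanding.  Before anything is
    embedded, a set [A] of [O(m)] vertices is set aside such that [A]
    contains [|Y|] neighbours of each small set [Y].  After the bulk of [Z] has
    been embedded, the pendant paths are used to link the tree to all vertices
    of [A]: trees growing at rate [g] are joined by an edge once they have [m]
    vertices, so that paths of scale [s] reach all but about [m / g^s] vertices
    of [A], few enough for the paths of the next scale.  Once every vertex of
    [A] carries the parent of a missing leaf of [Z], Hall's theorem matches the
    missing leaves with the unused vertices: [A] takes care of the small sets of
    unused vertices, and the Friedman-Pippenger condition of the small sets of
    leaves. *)

Lemma leq_card_bigcup_sum (I T : finType) (A : {set I}) (F : I -> {set T}) k :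
  {in A, forall i, #|F i| <= k i} ->
    #|\bigcup_(i in A) F i| <= \sum_(i in A) k i.
Proof.
move=> Fk; apply: (big_rec2 (fun (X : {set T}) l => #|X| <= l))
  => [|i l X iA leX].
  by rewrite cards0.
by apply: leq_trans (leq_card_setU _ _) _; exact: leq_add (Fk i iA) leX.
Qed.

Lemma leq_card_bigcup (I T : finType) (A : {set I}) (F : I -> {set T}) k :
  {in A, forall i, #|F i| <= k} -> #|\bigcup_(i in A) F i| <= #|A| * k.
Proof. by rewrite -sum_nat_const; exact: leq_card_bigcup_sum. Qed.

Lemma sum_mem_setI (I : finType) (A B : {set I}) :
  \sum_(i in A) (i \in B : nat) = #|A :&: B|.
Proof.
rewrite -sum1_card [RHS]big_mkcond [LHS]big_mkcond /=.
by apply: eq_bigr => i _; rewrite inE; case: (i \in A); case: (i \in B).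
Qed.

(** * Tight sets and Hall's theorem *)

Section Neighbourhood.

Variables (I W : finType) (N : I -> {set W}).

Definition nbhd (X : {set I}) : {set W} := \bigcup_(i in X) N i.

Lemma nbhdP (X : {set I}) w :
  reflect (exists2 i, i \in X & w \in N i) (w \in nbhd X).
Proof. exact: bigcupP. Qed.

Lemma nbhd0 : nbhd set0 = set0.
Proof. exact: big_set0. Qed.

Lemma nbhd1 i : nbhd [set i] = N i.
Proof. exact: big_set1. Qed.

Lemma nbhdU (X Y : {set I}) : nbhd (X :|: Y) = nbhd X :|: nbhd Y.
Proof. exact: bigcup_setU. Qed.

Lemma nbhdS (X Y : {set I}) : X \subset Y -> nbhd X \subset nbhd Y.
Proof. by move=> sXY; rewrite -(setUidPr sXY) nbhdU subsetUl. Qed.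

End Neighbourhood.

Lemma nbhd_setD (I W : finType) (N : I -> {set W}) (B : {set W}) X :
  nbhd (fun i => N i :\: B) X = nbhd N X :\: B.
Proof.
apply/setP => w; rewrite inE; apply/nbhdP/andP.
  by case=> i iX; rewrite inE => /andP[-> wN]; split=> //;
    apply/nbhdP; exists i.
by case=> wB /nbhdP[i iX wN]; exists i; rewrite // inE wB.
Qed.

Section TightSets.

Variables (I W : finType) (N : I -> {set W}) (f : I -> nat) (m : nat).

Hypothesis expand : forall X : {set I}, #|X| <= m.*2 ->
  \sum_(i in X) f i <= #|nbhd N X|.
Hypothesis expand_strict : forall X : {set I}, m <= #|X| -> #|X| <= m.*2 ->
  \sum_(i in X) f i < #|nbhd N X|.
Hypothesis m_gt0 : 0 < m.

Definition tight (X : {set I}) :=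
  (#|X| < m) && (\sum_(i in X) f i == #|nbhd N X|).

Lemma tightP (X : {set I}) : #|X| <= m.*2 ->
  \sum_(i in X) f i = #|nbhd N X| -> tight X.
Proof.
move=> leX eqX; rewrite /tight eqX eqxx andbT ltnNge; apply/negP.
by move=> /expand_strict/(_ leX); rewrite eqX ltnn.
Qed.

Lemma tight0 : tight set0.
Proof. by rewrite tightP ?cards0 // big_set0 nbhd0 cards0. Qed.

(* Submodularity of [#|nbhd X|] forces equality for the union, and
   [expand_strict] keeps the union small enough for [expand] to apply. *)
Lemma tightU (X Y : {set I}) : tight X -> tight Y -> tight (X :|: Y).
Proof.
move=> /andP[ltX /eqP eqX] /andP[ltY /eqP eqY].
have leU : #|X :|: Y| <= m.*2 by have := cardsUI X Y; lia.
have sum_UI : \sum_(i in X :|: Y) f i + \sum_(i in X :&: Y) f i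
            = \sum_(i in X) f i + \sum_(i in Y) f i.
  rewrite (big_setID Y) setIC setKU setDUl setDv setU0 /=.
  by rewrite [X in _ = X + _](big_setID Y) /= addnC [RHS]addnC addnCA.
have leI : \sum_(i in X :&: Y) f i <= #|nbhd N (X :&: Y)|.
  by apply: expand; apply: leq_trans (subset_leq_card (subsetIl _ _)) _; lia.
have sI : nbhd N (X :&: Y) \subset nbhd N X :&: nbhd N Y.
  by rewrite subsetI !nbhdS ?subsetIl ?subsetIr.
apply: tightP => //; have := expand leU; rewrite nbhdU.
have := subset_leq_card sI; have := cardsUI (nbhd N X) (nbhd N Y); lia.
Qed.

Definition max_tight (v : I) : {set I} :=
  \bigcup_(X | tight X && (v \notin X)) X.

Lemma tight_max_tight v : tight (max_tight v) && (v \notin max_tight v).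
Proof.
apply: (big_ind (fun X => tight X && (v \notin X))) => //.
  by rewrite tight0 inE.
move=> X Y /andP[tX vX] /andP[tY vY].
by rewrite tightU // inE negb_or vX.
Qed.

Lemma tight_extend v : 0 < f v ->
  exists2 w, w \in N v & forall X : {set I}, #|X| <= m.*2 ->
    \sum_(i in X) f i - (v \in X) <= #|nbhd N X :\ w|.
Proof.
move=> fv_gt0; have /andP[/andP[ltM /eqP eqM] vM] := tight_max_tight v.
have /subsetPn[w wN wM] : ~~ (N v \subset nbhd N (max_tight v)).
  apply/negP => sub; have := @expand (v |: max_tight v).
  rewrite cardsU1 vM (big_setU1 _ vM) /= nbhdU nbhd1 (setUidPr sub) -eqM.
  by move=> /(_ _) le; have : false by lia.
exists w => // X leX; have le := expand leX.
have [wX|wX] := boolP (w \in nbhd N X); last first.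
  rewrite (_ : nbhd N X :\ w = nbhd N X);
    first exact: leq_trans (leq_subr _ _) le.
  by apply/setDidPl; rewrite disjoint_sym disjoints1.
have := cardsD1 w (nbhd N X); rewrite wX => cX.
have [vX|vX] := boolP (v \in X); first by lia.
suff : \sum_(i in X) f i != #|nbhd N X| by lia.
apply: contraNneq wM => /(tightP leX) tX.
by apply: (subsetP (nbhdS _ (bigcup_sup X _))); rewrite ?tX.
Qed.

End TightSets.

Lemma hall (I W : finType) (w0 : W) (J : {set I}) (N : I -> {set W}) :
  (forall X : {set I}, X \subset J -> #|X| <= #|nbhd N X|) ->
  exists2 h : I -> W, {in J &, injective h} & {in J, forall i, h i \in N i}.
Proof.
have [k] := ubnP #|J|; elim: k => // k IHk in J N *; rewrite ltnS => leJ hallN.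
have [->|[v vJ]] := set_0Vmem J.
  by exists (fun=> w0) => [i j|i]; rewrite inE.
have [||||w wN expand_w] :=
    @tight_extend I W N (fun i => i \in J) #|I|.+1 _ _ _ v.
- move=> X _; rewrite sum_mem_setI.
  exact: leq_trans (hallN _ (subsetIr X J))
    (subset_leq_card (nbhdS _ (subsetIl _ _))).
- by move=> X ltX; have := max_card (mem X); rewrite leqNgt ltX.
- by [].
- by rewrite vJ.
have [||h injh hN] := IHk (J :\ v) (fun i => N i :\ w).
- by move: leJ; rewrite (cardsD1 v) vJ.
- move=> X /subsetD1P[sXJ vX]; rewrite nbhd_setD.
  have := expand_w X _; rewrite sum_mem_setI (setIidPl sXJ) (negPf vX) subn0.
  by apply; apply: leq_trans (max_card _) _; lia.
have hJ i : i \in J -> i != v -> (h i != w) && (h i \in N i).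
  by move=> iJ iv; have := hN i; rewrite !inE iv iJ => /(_ isT).
exists (fun i => if i == v then w else h i) => [i j iJ jJ|i iJ].
  case: eqVneq => [->|iv]; case: eqVneq => [->|jv] //.
  - by move=> wE; have := hJ j jJ jv; rewrite -wE eqxx.
  - by move=> wE; have := hJ i iJ iv; rewrite wE eqxx.
  - by apply: injh; rewrite !inE ?iv ?jv.
by case: eqVneq => [->//|/(hJ i iJ)/andP[]].
Qed.

Lemma subset_card_exists (T : finType) (X : {set T}) k : k <= #|X| ->
  exists2 Y : {set T}, Y \subset X & #|Y| = k.
Proof.
case/card_geqP => s [us <- ss]; exists [set x in s].
  by apply/subsetP => x; rewrite inE => /ss.
by rewrite cardsE (card_uniqP us).
Qed.

Lemma sum_mem (T : finType) (X : {set T}) : \sum_x (x \in X : nat) = #|X|.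
Proof.
by rewrite -sum1_card [RHS]big_mkcond; apply: eq_bigr => x _; case: (x \in X).
Qed.

Section Fibre.

Variables (V W : finType) (pi : W -> V).

Definition fibre (R : {set W}) (x : V) : {set W} := [set w in R | pi w == x].

Lemma card_fibres (R : {set W}) (X : {set V}) :
  #|[set w in R | pi w \in X]| = \sum_(x in X) #|fibre R x|.
Proof.
rewrite -sum1_card (partition_big pi (mem X)) => [|w];
  last by rewrite inE => /andP[].
apply: eq_bigr => x xX; rewrite sum1dep_card; apply: eq_card => w.
by rewrite !inE -andbA; case: eqP => [->|_]; rewrite ?(xX : x \in X) ?andbF.
Qed.

Lemma card_fibresT (R : {set W}) : \sum_x #|fibre R x| = #|R|.
Proof.
rewrite -(eq_bigl _ _ (fun x => in_setT x)) -card_fibres.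
by apply: eq_card => w; rewrite !inE andbT.
Qed.

Lemma card_fibreD1 (R : {set W}) w x : w \in R ->
  #|fibre R x| = (pi w == x) + #|fibre (R :\ w) x|.
Proof.
move=> wR; rewrite (cardsD1 w) inE wR; congr (_ + _).
by apply: eq_card => z; rewrite !inE andbA.
Qed.

End Fibre.

(** * Extendable sets *)

Section Extendable.

Variables (V : finType) (e : rel V) (D m : nat).

Definition nb (X : {set V}) : {set V} := nbhd (fun x => [set w | e x w]) X.

Lemma nbP (X : {set V}) w : reflect (exists2 x, x \in X & e x w) (w \in nb X).
Proof.
by apply: (iffP (nbhdP _ _ _)) => -[x xX]; rewrite ?inE => exw; exists x;
  rewrite ?inE.
Qed.

(* [B] is the set of vertices already used and [c x] counts the neighbours
   that were spent on [x]; the condition says that, with the vertices of [B]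
   gone, every small set still has [D - c x] private neighbours for each [x]. *)
Definition extendable (B : {set V}) (c : V -> nat) : Prop :=
  forall X : {set V}, #|X| <= m.*2 ->
    \sum_(x in X) (D - c x) <= #|nb X :\: B|.

Definition joined := forall X : {set V}, m <= #|X| -> #|V| < #|nb X| + m.

Definition room (k : nat) : Prop := k + m + m.*2 * D <= #|V|.

Lemma leq_room k l : k <= l -> room l -> room k.
Proof. by rewrite /room => kl; lia. Qed.

Lemma extendableW (B B' : {set V}) (c c' : V -> nat) :
  B' \subset B -> (forall v, c v <= c' v) -> extendable B c -> extendable B' c'.
Proof.
move=> sB lec ext X leX; apply: leq_trans (leq_trans (ext X leX) _).
  by apply: leq_sum => x _; apply: leq_sub2l.
exact/subset_leq_card/setDS.
Qed.

Lemma sum_sub_bump (X : {set V}) (c : V -> nat) v : c v < D ->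
  \sum_(x in X) (D - (c x + (x == v))) = \sum_(x in X) (D - c x) - (v \in X).
Proof.
move=> cv; have [vX|vX] := boolP (v \in X); last first.
  rewrite subn0; apply: eq_bigr => x xX.
  by case: eqVneq xX vX => [-> ->|_ _ _] //; rewrite addn0.
rewrite !(bigD1 v vX) /= eqxx (eq_bigr (fun x => D - c x))
  => [|x /andP[_ /negPf->]].
  by rewrite addn1 subnS -subn1 addnBAC // subn_gt0.
by rewrite addn0.
Qed.

Lemma extendable_add B c v : 0 < m -> joined -> extendable B c ->
  room #|B| -> c v < D ->
  exists w, [/\ w \notin B, e v w &
    extendable (w |: B) (fun x => c x + (x == v))].
Proof.
move=> m_gt0 join ext roomB cv.
have nbD X : nbhd (fun x => [set w | e x w] :\: B) X = nb X :\: B.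
  exact: nbhd_setD.
have [||||w] := @tight_extend V V (fun x => [set w | e x w] :\: B)
    (fun x => D - c x) m _ _ _ v => //.
- by move=> X leX; rewrite nbD; exact: ext.
- move=> X mX leX; rewrite nbD.
  have : \sum_(x in X) (D - c x) <= #|X| * D.
    by rewrite -sum_nat_const; apply: leq_sum => x _; rewrite leq_subr.
  have := join X mX; have := cardsID B (nb X).
  have := subset_leq_card (subsetIr (nb X) B).
  have : #|X| * D <= m.*2 * D by rewrite leq_mul2r leX orbT.
  by move: roomB; rewrite /room; lia.
- by rewrite subn_gt0.
rewrite !inE => /andP[wB evw] expand_w; exists w; split=> // X leX.
rewrite sum_sub_bump // setUC -setDDl -nbD; exact: expand_w.
Qed.

Lemma extendable_attach (B : {set V}) (c k : V -> nat) :
  0 < m -> joined -> extendable B c ->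
  (forall v, 0 < k v -> c v + k v <= D) -> room (#|B| + \sum_v k v) ->
  exists (R : {set V}) (pi : V -> V), [/\ [disjoint R & B],
    {in R, forall w, e (pi w) w}, forall v, #|fibre pi R v| = k v &
    extendable (B :|: R) (fun v => c v + k v)].
Proof.
move=> m_gt0 join; have [l] := ubnP (\sum_v k v).
elim: l => // l IHl in B c k *; rewrite ltnS => le_l ext ckD roomB.
have [k0|[u ku]] : (forall v, k v = 0) \/ exists u, 0 < k u.
  case: (pickP (fun u => 0 < k u)) => [u ku|k0]; first by right; exists u.
  by left=> v; apply/eqP; rewrite -leqn0 leqNgt k0.
- exists set0, id; split=> [|w||].
  - by rewrite -setI_eq0 set0I.
  - by rewrite inE.
  - by move=> v; rewrite k0; apply: eq_card0 => w; rewrite !inE.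
  - by apply: extendableW ext => [|v]; rewrite ?setU0 ?leq_addr.
have cuD : c u < D by apply: leq_trans (ckD u ku); rewrite -addn1 leq_add2l.
have [|w [wB euw ext_w]] := extendable_add m_gt0 join ext _ cuD.
  by apply: leq_room roomB; exact: leq_addr.
pose k' v := k v - (v == u).
have kE v : k v = (v == u) + k' v.
  by rewrite /k'; case: eqVneq => [->|_]; rewrite ?subnKC // subn0.
have sum_k : \sum_v k v = (\sum_v k' v).+1.
  rewrite (eq_bigr _ (fun v _ => kE v)) big_split /= (bigD1 u) //= eqxx big1.
    by rewrite addn0 add1n.
  by move=> v /negPf->.
have [|||R [pi [disR eR fibR extR]]] := IHl _ _ k' _ ext_w.
- by rewrite -sum_k.
- move=> v k'v; rewrite -addnA -kE ckD //; apply: leq_trans k'v _;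
    exact: leq_subr.
- by rewrite cardsU1 wB add1n addSnnS -sum_k.
have wR : w \notin R by have /disjointFl-> := disR; rewrite ?setU11.
exists (w |: R), (fun z => if z == w then u else pi z); split.
- rewrite disjoints_subset subUset sub1set inE wB -disjoints_subset.
  by apply: disjointWr disR; exact: subsetUr.
- by move=> z; rewrite !inE; case: eqVneq => [->|_] //=; exact: eR.
- move=> v; rewrite kE -fibR (card_fibreD1 _ _ (setU11 w R)) eqxx eq_sym
    setU1K //.
  congr (_ + _); apply: eq_card => z; rewrite !inE.
  by have [->|//] := eqVneq z w; rewrite (negPf wR).
- apply: extendableW extR => [|v]; last by rewrite -addnA -kE.
  by rewrite setUA (setUC B).
Qed.

Lemma extendable_detach (B R : {set V}) (c : V -> nat) (pi : V -> V) :
  [disjoint R & B] -> {in R, forall w, e (pi w) w} ->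
  extendable (B :|: R) (fun v => c v + #|fibre pi R v|) ->
  extendable B c.
Proof.
move=> disR eR ext X leX; pose Q := [set w in R | pi w \in X].
have le_sum : \sum_(x in X) (D - c x) <= #|nb X :\: (B :|: R)| + #|Q|.
  rewrite card_fibres; apply: leq_trans (leq_add (ext X leX) (leqnn _)).
  by rewrite -big_split /=; apply: leq_sum => x _; lia.
apply: leq_trans le_sum _.
have <- : #|(nb X :\: (B :|: R)) :|: Q| = #|nb X :\: (B :|: R)| + #|Q|.
  rewrite cardsU (_ : _ :&: Q = set0) ?cards0 ?subn0 //.
  by apply/setP => w; rewrite !inE; case: (w \in R); rewrite ?orbT ?andbF.
apply/subset_leq_card/subsetP => w; rewrite !inE negb_or -andbA.
case/orP => [/and3P[-> _ ->//]|/andP[wR piX]].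
by rewrite (disjointFr disR wR); apply/nbP; exists (pi w); rewrite ?eR.
Qed.

(* [ys] leads from [x] to a vertex of [B] through unused vertices. *)
Definition linking (B : {set V}) (c : V -> nat) (x : V) (ys : seq V) : Prop :=
  [/\ path e x ys, uniq (x :: ys),
      {in ys, forall v, (v \in B) = (v == last x ys)} &
      extendable (B :|: [set v in ys]) (fun v => c v + (v \in x :: ys))].

Lemma linking_detach (B R : {set V}) c (pi : V -> V) x ys (z := last x ys) :
  symmetric e -> [disjoint R & B] -> {in R, forall w, e (pi w) w} ->
  x \in R -> z \in R -> pi x \in B -> pi z \in B -> pi x != pi z ->
  linking (B :|: R) (fun v => c v + #|fibre pi R v|) x ys ->
  linking B c (pi x) (x :: rcons ys (pi z)).
Proof.
move=> e_sym disR eR xR zR pxB pzB pxz [pys uys ysB ext].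
have RB v : v \in R -> (v \in B) = false := disjointFr disR.
have Bys v : v \in B -> (v \in x :: ys) = false.
  apply: contraTF; rewrite inE => /orP[/eqP->|vys]; first by rewrite RB.
  have := ysB v vys; rewrite inE; case: eqVneq => [->|_]; first by rewrite RB.
  by case: (v \in B).
have memE v : (v \in pi x :: x :: rcons ys (pi z)) =
    (pi x == v) + (pi z == v) + (v \in x :: ys) :> nat.
  rewrite inE -rcons_cons mem_rcons inE ![_ == v]eq_sym.
  case: eqVneq => [->|_]; first by rewrite (negPf pxz) Bys.
  by case: eqVneq => [->|_]; first by rewrite Bys.
split.
- by rewrite /= eR //= rcons_path pys e_sym eR.
- by rewrite -rcons_cons cons_uniq mem_rcons inE negb_or pxz rcons_uniq
    !Bys ?uys.
- move=> v; rewrite /= last_rcons -rcons_cons mem_rcons inE.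
  case: eqVneq => [->|_] //= vys; apply/negbTE.
  by apply: contraTN vys => /Bys->.
apply: (@extendable_detach _ (R :\ x :\ z) _ pi).
- rewrite disjoints_subset; apply/subsetP => w;
    rewrite !in_setD1 => /and3P[wz wx wR].
  have wpz : w != pi z by apply: contraTneq pzB => <-; rewrite RB.
  have wys : w \notin ys.
    by apply: contra wz => wys; rewrite -(ysB w wys) inE wR orbT.
  rewrite in_setC in_setU in_set RB //= -rcons_cons mem_rcons !inE.
  by rewrite (negPf wpz) (negPf wx) (negPf wys).
- by move=> w; rewrite !inE => /and3P[_ _ /eR].
apply: extendableW ext => [|v].
  apply/subsetP => w; rewrite in_setU !in_setD1 !in_setU !in_set.
  rewrite -rcons_cons mem_rcons !inE.
  have [->|_] := eqVneq w (pi z); first by rewrite pzB.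
  have [->|_] := eqVneq w x; first by rewrite xR orbT.
  by case: (w \in B); case: (w \in ys); rewrite ?orbT //= ?orbF => /andP[].
rewrite memE -!addnA leq_add2l !addnA addnAC leq_add2r (card_fibreD1 _ _ xR).
have [zx|zx] := eqVneq z x.
  by rewrite zx setDDl setUid leq_add // leq_addl.
by rewrite -addnA leq_add2l -card_fibreD1 // !inE zx.
Qed.

Lemma linking_edge (B : {set V}) c x y : e x y -> x != y -> y \in B ->
  extendable B c -> linking B c x [:: y].
Proof.
move=> exy xy yB ext; split; rewrite /= ?exy ?inE ?xy //.
- by move=> v; rewrite inE => /eqP->; rewrite eqxx.
- apply: extendableW ext => [|v]; last exact: leq_addr.
  by apply/subsetP => v; rewrite !inE => /orP[//|/eqP->].
Qed.

Lemma joined_edge (X Y : {set V}) : joined -> m <= #|X| -> m <= #|Y| ->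
  exists x y, [/\ x \in X, y \in Y & e x y].
Proof.
move=> join mX mY; have [y] : exists y, y \in nb X :&: Y.
  apply/set0Pn; rewrite -card_gt0; have := cardsUI (nb X) Y.
  have : #|nb X :|: Y| <= #|V| := max_card _.
  by have := join X mX; lia.
by rewrite inE => /andP[/nbP[x xX exy] yY]; exists x, y.
Qed.

Lemma extendable_layer g (B : {set V}) c (Z : {set V}) :
  0 < m -> joined -> extendable B c -> {in Z, forall v, c v + g <= D} ->
  room (#|B| + g * #|Z|) ->
  exists (R : {set V}) (pi : V -> V),
    [/\ [disjoint R & B], {in R, forall w, e (pi w) w},
      forall v, #|fibre pi R v| = g * (v \in Z),
      extendable (B :|: R) (fun v => c v + g * (v \in Z)) & #|R| = g * #|Z|].
Proof.
move=> m_gt0 join ext cZ; rewrite -(sum_mem Z) big_distrr /= => roomB.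
have [|R [pi [disR eR fibR extR]]] := extendable_attach m_gt0 join ext _ roomB.
  by move=> v; case: (boolP (v \in Z)) => [/cZ|]; rewrite ?muln1 ?muln0.
exists R, pi; split=> //.
by rewrite -(card_fibresT pi) (eq_bigr _ (fun v _ => fibR v)).
Qed.

(* Grow [g]-ary trees of depth [k] from [X] and [Y]; the last layers are joined
   by an edge, and all branches off the resulting path are removed again. *)
Lemma extendable_link g k (B : {set V}) c (X Y : {set V}) :
  symmetric e -> 0 < m -> joined -> 1 < g -> extendable B c ->
  [disjoint X & Y] -> X :|: Y \subset B ->
  {in X :|: Y, forall v, c v + g <= D} ->
  (forall v, v \notin B -> c v + g <= D) ->
  m <= #|X| * g ^ k -> m <= #|Y| * g ^ k ->
  room (#|B| + 2 * (#|X| + #|Y|) * (g ^ k - 1)) ->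
  exists x ys,
    [/\ x \in X, last x ys \in Y, size ys = k.*2.+1 & linking B c x ys].
Proof.
move=> e_sym m_gt0 join g_gt1.
elim: k => [|k IHk] in B c X Y * => ext disXY sXY cXY cB mX mY roomB.
  rewrite !muln1 in mX mY; have [x [y [xX yY exy]]] := joined_edge join mX mY.
  exists x, [:: y]; split=> //; apply: linking_edge => //.
    by apply: contraTneq yY => <-; rewrite (disjointFr disXY).
  by rewrite (subsetP sXY) // inE yY orbT.
have gk : 0 < g ^ k by rewrite expn_gt0 (ltnW g_gt1).
have cardXY : #|X :|: Y| = #|X| + #|Y|.
  by rewrite cardsU (disjoint_setI0 disXY) cards0 subn0.
have [|R [pi [disR eR fibR extR cardR]]] := extendable_layer m_gt0 join ext cXY.
  by apply: leq_room roomB; rewrite leq_add2l cardXY expnS; nia.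
pose above (Z : {set V}) := [set w in R | pi w \in Z].
have above_notin Z v : v \in above Z -> v \notin B.
  by rewrite inE => /andP[vR _]; rewrite (disjointFr disR vR).
have card_above (Z : {set V}) : Z \subset X :|: Y -> #|above Z| = #|Z| * g.
  move=> sZ; rewrite card_fibres -sum_nat_const; apply: eq_bigr => v vZ.
  by rewrite fibR (subsetP sZ) ?muln1.
have cardX := card_above X (subsetUl _ _).
have cardY := card_above Y (subsetUr _ _).
have cR v : v \notin B -> c v + g * (v \in X :|: Y) + g <= D.
  by move=> vB; rewrite (contraNF (subsetP sXY v)) // muln0 addn0 cB.
have [|||||||x [ys]] := IHk _ _ (above X) (above Y) extR.
- rewrite -setI_eq0; apply/eqP/setP => w; rewrite !inE.
  case: (boolP (pi w \in X)) => [wX|]; last by rewrite !andbF.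
  by rewrite (disjointFr disXY wX) !andbF.
- by apply/subsetP => w; rewrite !inE => /orP[] /andP[-> _]; rewrite orbT.
- by move=> v /setUP[]/above_notin/cR.
- by move=> v; rewrite inE negb_or => /andP[/cR].
- by rewrite cardX -mulnA -expnS.
- by rewrite cardY -mulnA -expnS.
- apply: leq_room roomB; rewrite cardX cardY expnS.
  by have : #|B :|: R| <= #|B| + #|R| := leq_card_setU _ _;
    rewrite cardR cardXY; nia.
rewrite !inE => -[/andP[xR xX] /andP[zR zY] sys [pys uys ysB extys]].
exists (pi x), (x :: rcons ys (pi (last x ys))).
split; rewrite //= ?last_rcons ?size_rcons ?sys //.
apply: (@linking_detach _ R) => //;
  rewrite ?(subsetP sXY) ?inE ?xX ?zY ?orbT //.
  by apply: contraTneq zY => <-; rewrite (disjointFr disXY).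
by split=> //; apply: extendableW extys => // v; rewrite fibR.
Qed.

Lemma deficiency_set (A : {set V}) : joined -> 3 * m < #|A| ->
  exists2 Z : {set V}, #|Z| <= m &
    forall Y : {set V}, #|Y| <= m -> #|Y :\: Z| <= #|nb Y :&: A|.
Proof.
move=> join ltA.
pose bad (Y : {set V}) :=
  (#|Y| <= m.*2) && (#|nb Y :&: A| <= #|Y|).
have bad0 : bad set0 by rewrite /bad /nb nbhd0 set0I cards0.
have [Z /andP[leZ badZ] maxZ] := arg_maxnP (fun Y : {set V} => #|Y|) bad0.
have Z_m : #|Z| <= m.
  rewrite leqNgt; apply/negP => /ltnW /join; have := cardsUI (nb Z) A.
  by have : #|nb Z :|: A| <= #|V| := max_card _; lia.
exists Z => // Y leY; have [->|/set0Pn[y yD]] := eqVneq (Y :\: Z) set0.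
  by rewrite cards0.
have cardU : #|Z :|: Y| = #|Z| + #|Y :\: Z|.
  by have := cardsUI Z Y; have := cardsID Z Y; rewrite setIC; lia.
have leD := subset_leq_card (subsetDl Y Z).
have ltD : 0 < #|Y :\: Z| by apply/card_gt0P; exists y.
have : ~~ bad (Z :|: Y) by apply/negP => /maxZ; rewrite cardU; lia.
rewrite /bad cardU /nb nbhdU -!/(nb _) setIUl.
by have := cardsUI (nb Z :&: A) (nb Y :&: A); lia.
Qed.

Lemma dominating_set : 0 < m -> joined -> 1 < D ->
  extendable set0 (fun=> 0) -> room (4 * m).+1 ->
  exists (A : {set V}) (c : V -> nat), [/\ extendable A c,
    forall v, c v <= 2, #|A| <= (4 * m).+1 &
    forall Y : {set V}, #|Y| <= m -> #|Y| <= #|nb Y :&: A|].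
Proof.
move=> m_gt0 join D_gt1 ext0 roomV.
have [|X _ cardX] := @subset_card_exists V setT (3 * m).+1.
  by rewrite cardsT; move: roomV; rewrite /room; lia.
have [||A0 [pi0 [_ _ fib0 ext1]]] :=
    @extendable_attach set0 _ (fun v => v \in X) m_gt0 join ext0.
- by move=> v; case: (v \in X); lia.
- by apply: leq_room roomV; rewrite cards0 sum_mem cardX; lia.
have cardA0 : #|A0| = (3 * m).+1.
  by rewrite -(card_fibresT pi0) (eq_bigr _ (fun v _ => fib0 v)) sum_mem.
have [|Z leZ defZ] := @deficiency_set A0 join; first by rewrite cardA0.
have ext1' : extendable A0 (fun v => v \in X).
  by apply: extendableW ext1; rewrite ?set0U.
have [||A1 [pi1 [dis1 e1 fib1 ext2]]] :=
    @extendable_attach A0 _ (fun v => v \in Z) m_gt0 join ext1'.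
- by move=> v; case: (v \in Z); case: (v \in X); lia.
- by apply: leq_room roomV; rewrite cardA0 sum_mem; lia.
exists (A0 :|: A1), (fun v => (v \in X) + (v \in Z)); split=> //.
- by move=> v; case: (v \in X); case: (v \in Z).
- have cardA1 : #|A1| = #|Z|.
    by rewrite -(card_fibresT pi1) (eq_bigr _ (fun v _ => fib1 v)) sum_mem.
  by have := leq_card_setU A0 A1; rewrite cardA0 cardA1 => -[+ _]; lia.
move=> Y leY; have leYZ : #|Y :&: Z| <= #|nb Y :&: A1|.
  rewrite -sum_mem_setI -(eq_bigr _ (fun v _ => fib1 v)) -card_fibres.
  apply/subset_leq_card/subsetP => w; rewrite !inE => /andP[wA1 wY].
  by rewrite wA1 andbT; apply/nbP; exists (pi1 w); rewrite ?e1.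
rewrite -(cardsID Z Y) addnC; apply: leq_trans (leq_add (defZ Y leY) leYZ) _.
rewrite setIUr -cardsUI setIACA [A0 :&: A1]setIC (disjoint_setI0 dis1).
by rewrite setI0 cards0 addn0.
Qed.

End Extendable.

(** * Rooted trees *)

Record rooted_tree (U : finType) := RootedTree {
  tree_root : U;
  parent : U -> U;
  rootward : forall u, exists k, iter k parent u == tree_root
}.

Section RootedTree.

Variables (U : finType) (t : rooted_tree U).

Local Notation root := (tree_root t).
Local Notation parent := (parent t).

Definition depth (u : U) : nat := ex_minn (rootward t u).

Definition children (u : U) : {set U} := fibre parent [set~ root] u.

Definition ancestral (X : {set U}) : Prop :=
  root \in X /\ {in X, forall u, u != root -> parent u \in X}.

Lemma childrenE u v : (v \in children u) = (v != root) && (parent v == u).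
Proof. by rewrite !inE. Qed.

Lemma depth_root : depth root = 0.
Proof.
rewrite /depth; case: ex_minnP => k _ /(_ 0).
by rewrite eqxx leqn0 => /(_ isT)/eqP.
Qed.

Lemma depth_parent u : u != root -> depth u = (depth (parent u)).+1.
Proof.
rewrite /depth; case: ex_minnP => -[/= /eqP->|k]; first by rewrite eqxx.
rewrite iterSr => pk min_k _; congr _.+1; apply/eqP; rewrite eqn_leq.
case: ex_minnP => j pj min_j; rewrite min_j // andbT -ltnS min_k //.
by rewrite iterSr.
Qed.

Lemma depth_eq0 u : depth u = 0 -> u = root.
Proof. by move=> du; apply/eqP; apply: contra_eqT du => /depth_parent->. Qed.

Lemma depth_gt0 u : 0 < depth u -> u != root.
Proof. by apply: contraTneq => ->; rewrite depth_root. Qed.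

Lemma depth_iter i u : i <= depth u -> depth (iter i parent u) = depth u - i.
Proof.
elim: i => [|i IHi] lei; first by rewrite subn0.
have di := IHi (ltnW lei).
have := depth_parent (depth_gt0 _ : iter i parent u != root);
  rewrite di => /(_ _).
by rewrite subn_gt0 => /(_ lei); rewrite /= subnS => ->.
Qed.

Definition below v u :=
  (depth u <= depth v) && (iter (depth v - depth u) parent v == u).

Definition subtree u : {set U} := [set v | below v u].

Lemma below_refl u : below u u.
Proof. by rewrite /below leqnn subnn /= eqxx. Qed.

Lemma leq_below_depth v u : below v u -> depth u <= depth v.
Proof. by case/andP. Qed.

Lemma below_iter i v : i <= depth v -> below v (iter i parent v).
Proof. by move=> lei; rewrite /below depth_iter // leq_subr subKn // eqxx. Qed.

Lemma belowP v u :
  reflect (exists2 i, i <= depth v & u = iter i parent v) (below v u).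
Proof.
apply: (iffP idP) => [/andP[le /eqP<-]|[i lei ->]]; last exact: below_iter.
by exists (depth v - depth u); rewrite ?leq_subr.
Qed.

Lemma below_trans u v w : below w v -> below v u -> below w u.
Proof.
case/belowP => i lei -> /belowP[j]; rewrite depth_iter // => lej ->.
by rewrite -iterD; apply: below_iter; lia.
Qed.

Lemma below_root u : below u root.
Proof.
apply/belowP; exists (depth u) => //; apply/esym/depth_eq0.
by rewrite depth_iter // subnn.
Qed.

Lemma below_eq v u : below v u -> depth v <= depth u -> v = u.
Proof.
case/andP => le /eqP E le'; move: E.
by rewrite (_ : depth v - depth u = 0) //; lia.
Qed.

Lemma below_parent v : v != root -> below v (parent v).
Proof. by move/depth_parent => dv; apply: (@below_iter 1); rewrite dv. Qed.

Lemma below_parentl v u : below v u -> v != u -> below (parent v) u.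
Proof.
move=> /belowP[[|i] lei ->]; first by rewrite eqxx.
move=> _; rewrite iterSr; apply: below_iter; rewrite -ltnS -depth_parent //.
exact: depth_gt0 (leq_trans _ lei).
Qed.

Lemma below_chain v u u' : below v u -> below v u' -> depth u' <= depth u ->
  below u u'.
Proof.
case/belowP => i lei -> /belowP[j lej ->]; rewrite !depth_iter // => le.
have -> : j = (j - i) + i by lia.
by rewrite iterD; apply: below_iter; rewrite depth_iter //; lia.
Qed.

Lemma leq_card_subtree u v : below u v -> #|subtree u| <= #|subtree v|.
Proof.
move=> uv; apply/subset_leq_card/subsetP => x; rewrite !inE => xu.
exact: below_trans xu uv.
Qed.

Definition generation i u : {set U} :=
  [set x | (i <= depth x) && (iter i parent x == u)].

Definition generations i u : {set U} :=
  [set x | below x u && (depth x < depth u + i)].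

Variable b : nat.
Hypothesis card_children : forall u, #|children u| <= b.
Hypothesis b_gt1 : 1 < b.

Lemma card_generation i u : #|generation i u| <= b ^ i.
Proof.
elim: i u => [|i IHi] u.
  rewrite expn0 -(cards1 u); apply/subset_leq_card/subsetP => x.
  by rewrite !inE.
apply: (@leq_trans (#|children u| * b ^ i)); last first.
  by rewrite expnS leq_mul2r card_children orbT.
apply: leq_trans (leq_card_bigcup (fun v _ => IHi v)).
apply/subset_leq_card/subsetP => x; rewrite inE => /andP[ltx /= xu].
apply/bigcupP; exists (iter i parent x); last by rewrite inE eqxx (ltnW ltx).
rewrite childrenE xu andbT; apply: depth_gt0.
by rewrite depth_iter ?subn_gt0 // ltnW.
Qed.

Lemma card_generations i u : #|generations i u| <= b ^ i.
Proof.
elim: i => [|i IHi].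
  rewrite (_ : generations _ _ = set0) ?cards0 //.
  apply/setP => x; rewrite !inE addn0; apply/negP => /andP[/leq_below_depth];
    lia.
apply: (@leq_trans (b ^ i + b ^ i)); last first.
  by rewrite addnn -mul2n expnS leq_mul2r b_gt1 orbT.
apply: leq_trans (leq_add IHi (card_generation i u)).
apply: leq_trans (leq_card_setU _ _); apply/subset_leq_card/subsetP => x.
rewrite !inE addnS ltnS => /andP[xu]; rewrite xu leq_eqVlt.
case/orP => [/eqP dx|->] //; rewrite dx leq_addl /=; apply/orP; right.
by case/andP: xu => _; rewrite dx addKn.
Qed.

Lemma card_subtree_child (w : U) B : w != root ->
  (forall w', w' != root -> parent w' = parent w -> w' != w ->
    #|subtree w'| <= B) ->
  #|subtree (parent w)| <= #|subtree w| + (1 + b * B).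
Proof.
move=> wr small; set v := parent w.
have sub_v : subtree v \subset [set v] :|: (subtree w :|:
    \bigcup_(w' in children v :\ w) subtree w').
  apply/subsetP => x; rewrite !inE => xv; case: eqVneq => //= xnv.
  have [i lei vE] := belowP _ _ xv; case: i => [|i] in lei vE.
    by rewrite vE eqxx in xnv.
  have xi : below x (iter i parent x) by apply: below_iter; exact: ltnW.
  have [<-|iw] := eqVneq (iter i parent x) w; first by rewrite xi.
  apply/orP; right; apply/bigcupP; exists (iter i parent x);
    last by rewrite inE.
  rewrite in_setD1 iw childrenE -iterS -vE eqxx andbT; apply: depth_gt0.
  by rewrite depth_iter ?subn_gt0 // ltnW.
apply: leq_trans (subset_leq_card sub_v) _.
apply: leq_trans (leq_card_setU _ _) _; rewrite cards1 addnCA leq_add2l.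
apply: leq_trans (leq_card_setU _ _) _; rewrite leq_add2l.
apply: leq_trans (leq_card_bigcup (k := B) _) _.
  by move=> w'; rewrite !inE => /and3P[w'w w'r /eqP pw']; exact: small.
rewrite leq_mul2r; apply/orP; right; apply: leq_trans (card_children v).
exact/subset_leq_card/subD1set.
Qed.

End RootedTree.

(** * Partial embeddings of a tree *)

(* For large [X] few vertices of [W] are missed, so that they are dominated by
   vertices of [P :\: X]. *)
Lemma joined_hall (V : finType) (e : rel V) m (P W A : {set V}) :
  symmetric e -> joined e m -> #|P| <= #|W| -> A \subset P ->
  (forall Y : {set V}, #|Y| <= m -> #|Y| <= #|nb e Y :&: A|) ->
  (forall X : {set V}, X \subset P -> #|X| <= m.*2 ->
    #|X| <= #|nb e X :&: W|) ->
  forall X : {set V}, X \subset P -> #|X| <= #|nb e X :&: W|.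
Proof.
move=> e_sym join lePW sA domA small X sX.
have [/small->//|ltX] := leqP #|X| m.*2.
pose Y := W :\: nb e X.
have leYm : #|Y| <= m.
  have disY : Y :&: nb e X = set0 by rewrite setIDAC setDIl setDv setI0.
  have leX : m <= #|X| by lia.
  have := join X leX; have := cardsUI Y (nb e X); rewrite disY cards0.
  by have : #|Y :|: nb e X| <= #|V| := max_card _; lia.
have leY : #|Y| <= #|P :\: X|.
  apply: leq_trans (domA Y leYm) _; apply/subset_leq_card/subsetP => a.
  rewrite !inE => /andP[/nbP[w wY ewa] aA]; rewrite (subsetP sA) // andbT.
  apply: contraL wY => aX; rewrite inE negb_and negbK.
  by apply/orP; left; apply/nbP; exists a; rewrite // e_sym.
have := cardsID (nb e X) W; rewrite setIC -/Y.
by have := cardsID X P; rewrite (setIidPr sX); lia.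
Qed.

Section Embedding.

Variables (U V : finType) (t : rooted_tree U) (e : rel V).

Local Notation root := (tree_root t).
Local Notation parent := (parent t).

Definition embedding (X : {set U}) (f : U -> V) : Prop :=
  [/\ ancestral t X, {in X &, injective f} &
      {in X, forall u, u != root -> e (f (parent u)) (f u)}].

Definition glue (X : {set U}) (f h : U -> V) (u : U) : V :=
  if u \in X then f u else h u.

Lemma glue_in (X : {set U}) f h : {in X, glue X f h =1 f}.
Proof. by move=> u uX; rewrite /glue uX. Qed.

Lemma glue_notin (X R : {set U}) f h : [disjoint X & R] ->
  {in R, glue X f h =1 h}.
Proof. by move=> dis u uR; rewrite /glue (disjointFl dis uR). Qed.

Lemma imset_glue (X R : {set U}) f h : [disjoint X & R] ->
  glue X f h @: (X :|: R) = f @: X :|: h @: R.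
Proof.
move=> dis; rewrite imsetU (eq_in_imset (glue_in f h)).
by rewrite (eq_in_imset (glue_notin f h dis)).
Qed.

Lemma embedding_glue (X R : {set U}) f h : embedding X f -> [disjoint X & R] ->
  {in R, forall u, parent u \in X :|: R} -> {in R &, injective h} ->
  [disjoint f @: X & h @: R] ->
  {in R, forall u, e (glue X f h (parent u)) (h u)} ->
  embedding (X :|: R) (glue X f h).
Proof.
move=> [[rX pX] injf ef] dis pR injh disfh eh.
have fE := glue_in f h; have hE := glue_notin f h dis.
have neq u v : u \in X -> v \in R -> f u != h v.
  move=> uX vR; apply/eqP => fu; move: (disjointFr disfh (imset_f f uX)).
  by rewrite fu imset_f.
split; first split.
- by rewrite inE rX.
- move=> u /setUP[uX|uR] ur; last exact: pR.
  by rewrite inE pX.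
- move=> u v /setUP[uX|uR] /setUP[vX|vR].
  + by rewrite !fE //; exact: injf.
  + by rewrite fE // hE // => fu; have := neq u v uX vR; rewrite fu eqxx.
  + by rewrite hE // fE // => hu; have := neq v u vX uR; rewrite hu eqxx.
  + by rewrite !hE //; exact: injh.
- move=> u /setUP[uX|uR] ur; first by rewrite !fE ?pX // ef.
  by rewrite [in X in e _ X]hE // eh.
Qed.

Variables (D m : nat).
Hypothesis e_sym : symmetric e.
Hypothesis join : joined e m.
Hypothesis card_UV : #|U| = #|V|.

Lemma embedding_complete (L : {set U}) f c (A : {set V}) :
  root \notin L -> (forall u, u != root -> parent u \notin L) ->
  {in L &, injective parent} -> embedding (~: L) f ->
  extendable e D m (f @: ~: L) c -> {in L, forall u, c (f (parent u)) < D} ->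
  A \subset [set f (parent u) | u in L] ->
  (forall Y : {set V}, #|Y| <= m -> #|Y| <= #|nb e Y :&: A|) ->
  exists F, embedding setT F.
Proof.
move=> rL pL injp em ext cD sA domA; case: (em) => _ injf _.
have pT u : u \in L -> parent u \in ~: L.
  by move=> uL; rewrite inE pL //; apply: contraTneq uL => ->.
pose fp u := f (parent u); pose W := ~: (f @: ~: L).
have injfp : {in L &, injective fp}.
  by move=> u v uL vL /(injf _ _ (pT u uL) (pT v vL)); exact: injp.
have cardW : #|W| = #|L|.
  have leL : #|L| <= #|U| := max_card _.
  rewrite cardsCs setCK (card_in_imset injf) cardsCs setCK -card_UV.
  by rewrite subKn.
have [v0 _] : exists v0 : V, v0 \in V.
  by apply/card_gt0P; rewrite -card_UV; apply/card_gt0P; exists root.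
have [|h injh hN] :=
  @hall U V v0 L (fun u => [set w | e (fp u) w] :\: f @: ~: L).
  move=> X sX; rewrite nbhd_setD setDE -/W.
  have -> : nbhd (fun u => [set w | e (fp u) w]) X = nb e (fp @: X).
    by rewrite /nb /nbhd big_imset_idem //; exact: setUid.
  rewrite -(card_in_imset (sub_in2 (subsetP sX) injfp)).
  apply: (@joined_hall _ _ m (fp @: L) W A) => //; last exact: imsetS.
    by rewrite (card_in_imset injfp) cardW.
  move=> Z sZ leZ; rewrite -setDE; apply: leq_trans (ext Z leZ).
  rewrite -sum1_card; apply: leq_sum => v /(subsetP sZ)/imsetP[u uL ->].
  by rewrite subn_gt0 cD.
exists (glue (~: L) f h); rewrite -(setUCr L) setUC.
have dis : [disjoint ~: L & L] by rewrite disjoint_sym disjoints_subset setCK.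
apply: embedding_glue => //.
- by move=> u uL; rewrite inE pT.
- rewrite -setI_eq0; apply/eqP/setP => v; rewrite in_setI in_set0.
  apply/negP => /andP[vf /imsetP[u uL vh]]; have := hN u uL.
  by rewrite inE -vh vf.
- by move=> u uL; rewrite glue_in ?pT //; have := hN u uL;
    rewrite !inE => /andP[].
Qed.

End Embedding.

(** * Pendant paths and the embedding of spanning trees *)

(* [ppath x 0, ..., ppath x (2 * scale x + 2)] is a path of the tree going away
   from the root; it ends with a leaf and only its first vertex is in [core].
   Its odd number of interior vertices is the one of [extendable_link]. *)
Record pendant_paths (U : finType) (t : rooted_tree U) := PendantPaths {
  core : {set U};
  places : {set U};
  scale : U -> nat;
  ppath : U -> nat -> U;
  core_ancestral : ancestral t core;
  ppath_top : {in places, forall x, ppath x 0 \in core};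
  ppath_notin_core : {in places, forall x i, i <= (scale x).*2.+1 ->
    ppath x i.+1 \notin core};
  ppath_top_inj : {in places &, injective (ppath^~ 0)};
  ppath_inj : {in places &, forall x x' i j,
    i <= (scale x).*2.+1 -> j <= (scale x').*2.+1 ->
    ppath x i.+1 = ppath x' j.+1 -> x = x' /\ i = j};
  ppath_parent : {in places, forall x i, i <= (scale x).*2.+1 ->
    parent t (ppath x i.+1) = ppath x i};
  ppath_leaf : {in places, forall x u, u != tree_root t ->
    parent t u != ppath x (scale x).*2.+2}
}.

Section States.

Variables (U V : finType) (t : rooted_tree U) (e : rel V) (D m r : nat).
Hypothesis m_gt0 : 0 < m.
Hypothesis join : joined e m.
Hypothesis card_children : forall u, #|children t u| <= r.
Hypothesis card_UV : #|U| = #|V|.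

Local Notation root := (tree_root t).
Local Notation parent := (parent t).

(* [load s v] counts the neighbours spent on the vertex [v] of the graph. *)
Record state := State { dom : {set U}; img : U -> V; load : V -> nat }.

Definition occupied (s : state) : {set V} := img s @: dom s.

Definition agrees (s s' : state) : Prop :=
  dom s \subset dom s' /\ {in dom s, img s' =1 img s}.

Definition feasible (A : {set V}) (s : state) : Prop :=
  [/\ embedding t e (dom s) (img s), [disjoint occupied s & A],
      extendable e D m (occupied s :|: A) (load s),
      {in dom s, forall u, load s (img s u) <= 4 + #|children t u :&: dom s|} &
      forall v, v \notin occupied s -> load s v <= 3].

Lemma card_occupied A s : feasible A s -> #|occupied s :|: A| = #|dom s| + #|A|.
Proof.
case=> -[_ inj_img _] dis _ _ _; have := cardsUI (occupied s) A.
by rewrite (disjoint_setI0 dis) cards0 addn0 (card_in_imset inj_img).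
Qed.

Definition glue_state (s : state) (R : {set U}) (h : U -> V) (spent : pred V) :=
  State (dom s :|: R) (glue (dom s) (img s) h) (fun v => load s v + spent v).

Lemma agrees_glue s (R : {set U}) h spent : agrees s (glue_state s R h spent).
Proof. by split; [exact: subsetUl | exact: glue_in]. Qed.

Lemma feasible_glue (A A' : {set V}) s (R : {set U}) h (spent : pred V) :
  feasible A s -> [disjoint dom s & R] ->
  embedding t e (dom s :|: R) (glue (dom s) (img s) h) ->
  [disjoint occupied s & h @: R] -> [disjoint h @: R & A'] -> A' \subset A ->
  extendable e D m (occupied s :|: h @: R :|: A')
    (fun v => load s v + spent v) ->
  {in dom s, forall u, spent (img s u) -> children t u :&: R != set0} ->
  (forall v, spent v -> v \in occupied s :|: h @: R) ->
  feasible A' (glue_state s R h spent).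
Proof.
move=> [_ disA _ loadX load_out] disR em dish disA' sA ext kidR spentP.
have occE : occupied (glue_state s R h spent) = occupied s :|: h @: R.
  exact: imset_glue.
split; rewrite ?occE //.
- rewrite disjoint_sym disjoints_subset setCU subsetI -!disjoints_subset.
  by rewrite disjoint_sym (disjointWr sA disA) disjoint_sym.
- move=> u /setUP[uX|uR] /=; last first.
    rewrite (glue_notin _ _ disR) //.
    have hu : h u \notin occupied s by rewrite (disjointFl dish) ?imset_f.
    by apply: leq_trans (leq_add (load_out _ hu) (leq_b1 _)) (leq_addr _ _).
  rewrite glue_in // setIUr cardsU setIACA setIid (disjoint_setI0 disR) setI0.
  rewrite cards0 subn0 addnA; apply: leq_add; first exact: loadX.
  by case: (boolP (spent _)) => // /(kidR u uX); rewrite -card_gt0.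
- move=> v; rewrite /= => vN; have -> : spent v = false.
    by apply: contraNF vN; exact: spentP.
  by rewrite addn0 load_out //; apply: contra vN; rewrite inE => ->.
Qed.

Hypothesis r_lt : r + 4 < D.

Lemma feasible_add A s u : feasible A s -> u \notin dom s -> u != root ->
  parent u \in dom s -> room V D m (#|dom s| + #|A|) ->
  exists s', [/\ feasible A s', dom s' = u |: dom s & agrees s s'].
Proof.
move=> fs uX ur puX; rewrite -(card_occupied fs) => roomV.
case: (fs) => em disA ext loadX _.
have load_lt : load s (img s (parent u)) < D.
  apply: leq_ltn_trans (loadX _ puX) _; apply: leq_ltn_trans r_lt.
  rewrite addnC leq_add2r; apply: leq_trans (card_children (parent u)).
  exact/subset_leq_card/subsetIl.
have [w [wB ew ext_w]] := extendable_add m_gt0 join ext roomV load_lt.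
move: wB; rewrite inE negb_or => /andP[wX wA].
have disX : [disjoint dom s & [set u]] by rewrite disjoint_sym disjoints1.
have im1 : (fun=> w) @: [set u] = [set w] by rewrite imset_set1.
have disw : [disjoint occupied s & (fun=> w) @: [set u]].
  by rewrite im1 disjoint_sym disjoints1.
exists (glue_state s [set u] (fun=> w) (pred1 (img s (parent u)))).
split; last exact: agrees_glue; last by rewrite /= setUC.
apply: (feasible_glue fs) => //.
- apply: embedding_glue => //.
  + by move=> v; rewrite inE => /eqP->; rewrite inE puX.
  + by move=> v v'; rewrite !inE => /eqP-> /eqP->.
  + by move=> v; rewrite inE => /eqP->; rewrite glue_in.
- by rewrite im1 disjoints1.
- by rewrite im1 (setUC _ [set w]) -setUA.
- case: em => _ inj_img _ v vX /= /eqP/(inj_img _ _ vX puX) ->.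
  by apply/set0Pn; exists u; rewrite inE childrenE ur eqxx set11.
- by move=> v /eqP->; rewrite inE imset_f.
Qed.

Lemma feasible_fill A s (X : {set U}) : feasible A s -> dom s \subset X ->
  ancestral t X -> room V D m (#|X| + #|A|) ->
  exists s', [/\ feasible A s', dom s' = X & agrees s s'].
Proof.
have [k] := ubnP #|X :\: dom s|; elim: k => // k IHk in s *.
rewrite ltnS => leX fs sX ancX roomX.
have [XD|[u0 u0X]] := set_0Vmem (X :\: dom s).
  exists s; split=> //; apply/eqP; by rewrite eqEsubset sX -setD_eq0 XD eqxx.
have [u /setDP[uX uD] min_u] := arg_minnP (depth t) u0X.
have [[[rD _] _ _] _ _ _ _] := fs.
have ur : u != root by apply: contraNneq uD => ->.
have puD : parent u \in dom s.
  apply: contraT => puD.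
  suff : depth t u <= depth t (parent u) by rewrite (depth_parent ur) ltnn.
  by apply/min_u/setDP; rewrite (proj2 ancX).
have [|s1 [fs1 dom1 [sub1 agr1]]] := feasible_add fs uD ur puD.
  by apply: leq_room roomX; rewrite leq_add2r subset_leq_card.
have [||s' [fs' dom' [sub' agr']]] := IHk s1 _ fs1 _ ancX roomX.
- move: leX; rewrite dom1 (cardsD1 u) inE uD uX /=.
  by rewrite setDDl [dom s :|: _]setUC.
- by rewrite dom1 subUset sub1set uX.
exists s'; split=> //; split; first exact: subset_trans sub1 sub'.
by move=> v vD; rewrite agr' ?agr1 // (subsetP sub1).
Qed.

Lemma feasible_root A c : extendable e D m A c -> (forall v, c v <= 2) ->
  room V D m #|A| -> exists s, feasible A s /\ dom s = [set root].
Proof.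
move=> ext c2 roomA.
have [v0 _] : exists v0 : V, v0 \in V.
  by apply/card_gt0P; rewrite -card_UV; apply/card_gt0P; exists root.
have [|w [wA _ ext_w]] := extendable_add (v := v0) m_gt0 join ext roomA.
  by apply: leq_ltn_trans (c2 _) (leq_ltn_trans _ r_lt); lia.
have c3 v : c v + (v == v0) <= 3 by apply: leq_add (c2 v) (leq_b1 _).
exists (State [set root] (fun=> w) (fun v => c v + (v == v0))); split=> //.
have occE : occupied (State [set root] (fun=> w) (fun v => c v + (v == v0))) =
  [set w].
  exact: imset_set1.
split; rewrite ?occE ?disjoints1 //; first split=> /=.
- by split=> [|u]; rewrite !inE // => /eqP-> /eqP.
- by move=> u u'; rewrite !inE => /eqP-> /eqP->.
- by move=> u; rewrite inE => /eqP-> /eqP.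
- by move=> u _; apply: leq_trans (c3 _) _;
    rewrite (leq_trans _ (leq_addr _ _)).
- by move=> v _; exact: c3.
Qed.

End States.

Section PendantPaths.

Variables (U : finType) (t : rooted_tree U) (P : pendant_paths t).

Definition foot (x : U) : U := ppath P x (scale P x).*2.+1.

Definition tip (x : U) : U := ppath P x (scale P x).*2.+2.

Definition interior (x : U) : {set U} :=
  [set ppath P x i.+1 | i : 'I_(scale P x).*2.+1].

Lemma interiorP x u :
  reflect (exists2 i, i < (scale P x).*2.+1 & u = ppath P x i.+1)
    (u \in interior x).
Proof.
apply: (iffP imsetP) => [[i _ ->]|[i lti ->]]; first by exists i.
by exists (Ordinal lti).
Qed.

Lemma foot_interior x : foot x \in interior x.
Proof. by apply/interiorP; exists (scale P x).*2. Qed.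

Lemma interior_notin_root x : x \in places P ->
  {in interior x, forall u, u != tree_root t}.
Proof.
move=> xP u /interiorP[i lti ->];
  apply: contraNneq (ppath_notin_core xP (ltnW lti)).
by move=> ->; case: (core_ancestral P).
Qed.

Lemma disjoint_interior x x' : x \in places P -> x' \in places P -> x != x' ->
  [disjoint interior x & interior x'].
Proof.
move=> xP x'P xx'; rewrite -setI_eq0; apply/eqP/setP => u;
  rewrite in_setI in_set0.
apply/negP => /andP[/interiorP[i lti ->] /interiorP[j ltj]].
by case/(ppath_inj xP x'P (ltnW lti) (ltnW ltj)) => E; rewrite E eqxx in xx'.
Qed.

Lemma disjoint_core_interior x : x \in places P ->
  [disjoint core P & interior x].
Proof.
move=> xP; rewrite disjoint_sym disjoints_subset; apply/subsetP => u.
by case/interiorP => i lti ->; rewrite inE (ppath_notin_core xP) // ltnW.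
Qed.

Lemma tip_notin_interior x x' : x \in places P -> x' \in places P ->
  tip x \notin interior x'.
Proof.
move=> xP x'P; apply/interiorP => -[j ltj].
case/(ppath_inj xP x'P (leqnn _) (ltnW ltj)) => E ij.
by rewrite -ij E ltnn in ltj.
Qed.

Lemma tip_notin_core x : x \in places P -> tip x \notin core P.
Proof. by move=> xP; apply: ppath_notin_core. Qed.

Lemma tip_inj : {in places P &, injective tip}.
Proof. by move=> x x' xP x'P /(ppath_inj xP x'P (leqnn _) (leqnn _))[]. Qed.

Lemma foot_inj : {in places P &, injective foot}.
Proof. by move=> x x' xP x'P /(ppath_inj xP x'P (leqnSn _) (leqnSn _))[]. Qed.

Lemma parent_tip x : x \in places P -> parent t (tip x) = foot x.
Proof. by move=> xP; apply: ppath_parent. Qed.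

End PendantPaths.

Section Linking.

Variables (U V : finType) (t : rooted_tree U) (e : rel V) (D m r g : nat).
Variable P : pendant_paths t.
Hypothesis e_sym : symmetric e.
Hypothesis m_gt0 : 0 < m.
Hypothesis join : joined e m.
Hypothesis card_children : forall u, #|children t u| <= r.
Hypothesis g_gt1 : 1 < g.
Hypothesis D_large : r + 4 + g <= D.
Hypothesis card_UV : #|U| = #|V|.

Local Notation root := (tree_root t).
Local Notation parent := (parent t).
Local Notation feasible := (feasible t e D m).
Local Notation foot := (foot P).
Local Notation tip := (tip P).
Local Notation interior := (interior P).

Lemma embedding_path s x ys : x \in places P ->
  embedding t e (dom s) (img s) -> ppath P x 0 \in dom s ->
    [disjoint dom s & interior x] ->
  path e (img s (ppath P x 0)) ys -> uniq ys -> size ys = (scale P x).*2.+1 ->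
  [disjoint occupied s & [set v in ys]] ->
  exists h, [/\ embedding t e (dom s :|: interior x) (glue (dom s) (img s) h),
    h @: interior x = [set v in ys] & h (foot x) =
      last (img s (ppath P x 0)) ys].
Proof.
move=> xP em topX disX pys uys sys disys; set v0 := img s _ in pys *.
set n := (scale P x).*2.+1 in sys.
pose zs := mkseq (fun i => ppath P x i.+1) n.
have uzs : uniq zs.
  apply/mkseq_uniqP => i j; rewrite !inE => lti ltj.
  by case/(ppath_inj xP xP (ltnW lti) (ltnW ltj)).
have zsE i : i < n -> index (ppath P x i.+1) zs = i.
  move=> lti; have -> : ppath P x i.+1 = nth x zs i by rewrite nth_mkseq.
  by rewrite index_uniq ?size_mkseq.
pose h u := nth v0 ys (index u zs).
have hE i : i < n -> h (ppath P x i.+1) = nth v0 ys i.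
  by move=> lti; rewrite /h zsE.
have imh : h @: interior x = [set v in ys].
  apply/setP => v; rewrite inE; apply/imsetP/(nthP v0).
    by case=> _ /interiorP[i lti ->] ->; exists i; rewrite ?sys ?hE.
  case=> i; rewrite sys => lti <-; exists (ppath P x i.+1); rewrite ?hE //.
  by apply/interiorP; exists i.
exists h; split=> //; last by rewrite hE // (last_nth v0) sys.
apply: embedding_glue; rewrite ?imh //.
- move=> _ /interiorP[i lti ->];
    rewrite (ppath_parent xP) ?(ltnW lti) // in_setU.
  case: i lti => [|i] lti; first by rewrite topX.
  by apply/orP; right; apply/interiorP; exists i; rewrite // ltnW.
- move=> _ _ /interiorP[i lti ->] /interiorP[j ltj ->]; rewrite !hE //.
  by move/eqP; rewrite nth_uniq ?sys // => /eqP->.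
- move=> _ /interiorP[i lti ->]; rewrite (ppath_parent xP) ?(ltnW lti) // hE //.
  have := pathP v0 pys i; rewrite sys => /(_ lti); congr (e _ _).
  case: i lti => [|i] lti; first by rewrite glue_in.
  rewrite (glue_notin _ _ disX) ?hE ?(ltnW lti) //.
  by apply/interiorP; exists i; rewrite // ltnW.
Qed.

Lemma feasible_path A s x ys (a := last (img s (ppath P x 0)) ys) :
  feasible A s -> x \in places P -> ppath P x 0 \in dom s ->
  [disjoint dom s & interior x] -> a \in A -> size ys = (scale P x).*2.+1 ->
  linking e D m (occupied s :|: A) (load s) (img s (ppath P x 0)) ys ->
  exists s', [/\ feasible (A :\ a) s', dom s' = dom s :|: interior x,
    agrees s s' & img s' (foot x) = a].
Proof.
move=> fs xP topX disX aA sys [pys /andP[_ uys] ysB extys].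
case: (fs) => em disA _ _ _; case: (em) => _ inj_img _.
have ysA v : v \in ys -> v \in A -> v = a.
  by move=> vys vA; apply/eqP; rewrite -(ysB v vys) inE vA orbT.
have disys : [disjoint occupied s & [set v in ys]].
  rewrite disjoints_subset; apply/subsetP => v vocc; rewrite !inE.
  apply: contraTN vocc => vys; have := ysB v vys; rewrite inE.
  by case: eqVneq => [->|_ /norP[]//]; rewrite (disjointFl disA aA).
have [h [em' imh lasth]] := embedding_path xP em topX disX pys uys sys disys.
exists (glue_state s (interior x) h (mem (img s (ppath P x 0) :: ys))).
split; rewrite //= ?(glue_notin _ _ disX) ?foot_interior //;
  last exact: agrees_glue.
apply: (feasible_glue fs) => //; rewrite ?imh ?subD1set //.
- rewrite disjoints_subset; apply/subsetP => v; rewrite !inE => vys.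
  rewrite negb_and negbK; case: (boolP (v \in A)) => [/(ysA v vys)->|].
    by rewrite eqxx.
  by rewrite orbT.
- apply: extendableW extys => [|v]; last exact: leqnn.
  by rewrite -setUA (setUC [set v in ys]) setUA setSU // setUS // subD1set.
- move=> u uX /=; rewrite inE => /orP[/eqP|uys'].
    move/(inj_img _ _ uX topX) => ->; apply/set0Pn.
    exists (ppath P x 1); rewrite inE childrenE ppath_parent // eqxx andbT.
    have x1 : ppath P x 1 \in interior x by apply/interiorP; exists 0.
    by rewrite x1 (interior_notin_root xP).
  by have := disjointFr disys (imset_f (img s) uX); rewrite inE uys'.
- move=> v /=; rewrite inE => /orP[/eqP->|vys]; last by rewrite !inE vys orbT.
  by rewrite inE imset_f.
Qed.

Lemma feasible_link A s k (X : {set U}) (Y : {set V}) :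
  feasible A s -> X \subset places P -> {in X, forall x, scale P x = k} ->
  core P \subset dom s -> {in X, forall x, [disjoint dom s & interior x]} ->
  Y \subset A -> m <= #|X| * g ^ k -> m <= #|Y| * g ^ k ->
  room V D m (#|dom s| + #|A| + 2 * (#|X| + #|Y|) * (g ^ k - 1)) ->
  exists x a s', [/\ x \in X, a \in Y, feasible (A :\ a) s',
    dom s' = dom s :|: interior x & agrees s s' /\ img s' (foot x) = a].
Proof.
move=> fs sX scX sCX disX sYA mX mY roomV; rewrite -(card_occupied fs) in roomV.
case: (fs) => -[_ inj_img _] disA ext loadX load_out.
have top_dom x : x \in X -> ppath P x 0 \in dom s.
  by move=> xX; rewrite (subsetP sCX) // ppath_top // (subsetP sX).
pose X0 := [set img s (ppath P x 0) | x in X].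
have cardX0 : #|X0| = #|X|.
  apply: card_in_imset => x x' xX x'X
    /(inj_img _ _ (top_dom x xX) (top_dom x' x'X)).
  by apply: ppath_top_inj; exact: (subsetP sX).
have sX0 : X0 \subset occupied s.
  by apply/subsetP => _ /imsetP[x xX ->]; rewrite imset_f ?top_dom.
have load_g v : load s v <= r + 4 -> load s v + g <= D.
  by move=> le; apply: leq_trans D_large; rewrite leq_add2r.
have load_out_g v : v \notin occupied s -> load s v + g <= D.
  by move=> vN; rewrite load_g // (leq_trans (load_out v vN)) //; lia.
rewrite -cardX0 in mX roomV.
have [||||v0 [ys [/imsetP[x xX ->] aY sys link]]] :=
    extendable_link e_sym m_gt0 join g_gt1 ext _ _ _ _ mX mY roomV.
- by apply: disjointWl sX0 _; apply: disjointWr sYA _.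
- by rewrite subUset (subset_trans sX0) ?subsetUl //
    (subset_trans sYA) ?subsetUr.
- move=> v /setUP[/imsetP[x xX ->]|vY]; last first.
    by rewrite load_out_g // (disjointFl disA) ?(subsetP sYA).
  rewrite load_g // (leq_trans (loadX _ (top_dom x xX))) // addnC leq_add2r.
  apply: leq_trans (card_children (ppath P x 0)).
  exact/subset_leq_card/subsetIl.
- by move=> v; rewrite inE negb_or => /andP[/load_out_g].
rewrite -(scX x xX) in sys.
have [s' [fs' dom' agr foot_a]] :=
  feasible_path fs (subsetP sX x xX) (top_dom x xX)
  (disX x xX) (subsetP sYA _ aY) sys link.
by exists x, (last (img s (ppath P x 0)) ys), s'.
Qed.

Variables (S : nat) (A0 : {set V}).
Hypothesis S_gt0 : 0 < S.
Hypothesis gS_large : m <= g ^ S.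
Hypothesis many_places : forall k, 0 < k <= S ->
  6 * g ^ (S.+1 - k) <= #|[set x in places P | scale P x == k]|.
Hypothesis places_large : 6 * m + 4 * g ^ S + m.*2 * D < #|places P|.
Hypothesis card_A0 : #|A0| <= (4 * m).+1.

Definition linked (s : state U V) : {set U} :=
  [set x in places P | foot x \in dom s].

(* [A] is the part of [A0] that is still to be linked to the tree. *)
Definition progress (A : {set V}) (s : state U V) : Prop :=
  [/\ feasible A s, core P \subset dom s,
      {in places P :\: linked s, forall x, [disjoint dom s & interior x]},
      {in places P, forall x, tip x \notin dom s} &
      A \subset A0 /\ A0 :\: A \subset [set img s (foot x) | x in linked s]].

Let card_tips : #|tip @: places P| = #|places P| :=
  card_in_imset (@tip_inj _ _ P).

Lemma room_missing (X : {set U}) (A : {set V}) :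
  [disjoint X & tip @: places P] -> A \subset A0 ->
  room V D m (#|X| + #|A| + 4 * g ^ S).
Proof.
move=> dis /subset_leq_card leA; have := cardsUI X (tip @: places P).
rewrite (disjoint_setI0 dis) cards0 addn0 card_tips.
have : #|X :|: tip @: places P| <= #|V| by rewrite -card_UV max_card.
by rewrite /room; lia.
Qed.

Lemma disjoint_tips (X : {set U}) : {in places P, forall x, tip x \notin X} ->
  [disjoint X & tip @: places P].
Proof.
move=> tipX; rewrite disjoint_sym disjoints_subset.
by apply/subsetP => _ /imsetP[x xP ->]; rewrite inE tipX.
Qed.

Lemma progress_step k A s : 0 < k <= S -> progress A s -> g ^ (S - k) <= #|A| ->
  g ^ (S - k) <= #|[set x in places P :\: linked s | scale P x == k]| ->
  exists x a s', [/\ x \in places P :\: linked s, scale P x = k, a \in A,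
    linked s' = x |: linked s & progress (A :\ a) s'].
Proof.
move=> /andP[k_gt0 le_kS] [fs sCs disI tipX [sA cover]] leA leP.
have roomA := room_missing (disjoint_tips tipX) sA.
have [X sX cardX] := subset_card_exists leP.
have [Y sY cardY] := subset_card_exists leA.
have XP x : x \in X -> x \in places P :\: linked s /\ scale P x = k.
  by move=> /(subsetP sX); rewrite inE => /andP[-> /eqP].
have card_gk : m <= g ^ (S - k) * g ^ k by rewrite -expnD subnK.
have roomXY : room V D m (#|dom s| + #|A| + 2 * (#|X| + #|Y|) * (g ^ k - 1)).
  apply: leq_room roomA;
    rewrite leq_add2l cardX cardY addnn -mul2n mulnA -mulnA.
  by rewrite leq_mul2l mulnBr -expnD subnK // muln1 leq_subr.
have [|||||x [a [s' [xX aY fs' dom' [[subX agr] foot_a]]]]] :=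
    feasible_link fs _ _ sCs _ sY _ _ roomXY; rewrite ?cardX ?cardY //.
- by apply/subsetP => x /XP[/setDP[]].
- by move=> x /XP[].
- by move=> x /XP[/disI].
have [xPl scx] := XP x xX; have [xP xN] := setDP xPl.
have linkedE : linked s' = x |: linked s.
  apply/setP => x'; rewrite !inE dom' inE; have [->|x'x] := eqVneq x' x.
    by rewrite xP foot_interior orbT.
  case: (boolP (x' \in places P)) => //= x'P.
  have dis := disjoint_interior x'P xP x'x.
  by rewrite (disjointFr dis (foot_interior _ _)) orbF.
exists x, a, s'; split=> //; first exact: (subsetP sY).
split=> //.
- exact: subset_trans sCs subX.
- move=> x' /setDP[x'P]; rewrite linkedE !inE negb_or => /andP[x'x x'N].
  rewrite dom' disjoint_sym disjoints_subset setCU subsetI -!disjoints_subset.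
  apply/andP; split; last exact: disjoint_interior.
  by rewrite disjoint_sym disI // inE x'P andbT; rewrite inE.
- move=> x' x'P; rewrite dom' inE negb_or tipX //.
  exact: tip_notin_interior.
split; first exact: subset_trans (subD1set _ _) sA.
apply/subsetP => a'; rewrite !inE negb_and negbK linkedE.
case/andP=> /orP[/eqP->|a'A] a'A0; apply/imsetP.
  by exists x; rewrite ?setU11.
have /imsetP[x' x'L ->] : a' \in [set img s (foot x) | x in linked s].
  by rewrite (subsetP cover) // inE a'A.
exists x'; first by rewrite inE x'L orbT.
by rewrite agr //; move: x'L; rewrite inE => /andP[].
Qed.

Lemma progress_stage k A s : 0 < k <= S -> progress A s ->
  {in linked s, forall x, scale P x <= k} ->
  #|[set x in linked s | scale P x == k]| + #|A| <= 5 * g ^ (S.+1 - k) ->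
  exists A' s', [/\ progress A' s', {in linked s', forall x, scale P x <= k} &
    #|A'| < g ^ (S - k)].
Proof.
move=> k_range; have [l] := ubnP #|A|.
elim: l => // l IHl in A s *; rewrite ltnS => leA pr sc_le few.
have [ltA|geA] := ltnP #|A| (g ^ (S - k)); first by exists A, s.
have many_unlinked : g ^ (S - k) <=
  #|[set x in places P :\: linked s | scale P x == k]|.
  have := many_places k_range.
  have -> : [set x in places P | scale P x == k] =
      [set x in places P :\: linked s | scale P x == k] :|:
      [set x in linked s | scale P x == k].
    apply/setP => x; rewrite !inE; case: (x \in places P) => //=.
    by case: (foot x \in dom s); rewrite ?orbF.
  move=> /leq_trans/(_ (leq_card_setU _ _)).
  have : g ^ (S - k) <= g ^ (S.+1 - k) by rewrite leq_exp2l // leq_sub2r.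
  by lia.
have [x [a [s' [/setDP[xP xN] scx aA linkedE pr']]]] :=
  progress_step k_range pr geA many_unlinked.
apply: (IHl _ _ _ pr').
- by move: leA; rewrite (cardsD1 a) aA.
- by move=> x'; rewrite linkedE !inE => /orP[/eqP->|x'L];
    rewrite ?scx ?sc_le ?inE.
rewrite linkedE; apply: leq_trans few;
  rewrite [#|A|](cardsD1 a) aA addnA leq_add2r.
have -> : [set x' in x |: linked s | scale P x' == k] =
    x |: [set x' in linked s | scale P x' == k].
  by apply/setP => x'; rewrite !inE; case: eqVneq => [->|_] //=;
    rewrite scx eqxx.
by rewrite cardsU1 addnC leq_add2l leq_b1.
Qed.

(* Paths of scale [k] link all but [g ^ (S - k)] vertices of [A0]. *)
Lemma progress_complete s : progress A0 s -> linked s = set0 ->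
  exists s', progress set0 s'.
Proof.
move=> pr linked0.
suff stages k : k <= S -> exists A s', [/\ progress A s',
    {in linked s', forall x, scale P x <= k}, #|A| <= 5 * g ^ (S - k) &
    0 < k -> #|A| < g ^ (S - k)].
  have [A [s' [pr' _ _ /(_ S_gt0)]]] := stages S (leqnn S).
  rewrite subnn expn0 ltnS leqn0 cards_eq0 => /eqP A_eq0.
  by exists s'; rewrite -A_eq0.
elim: k => [_|k IHk ltk].
  exists A0, s; split=> //; first by move=> x; rewrite linked0 inE.
  by rewrite subn0; apply: leq_trans card_A0 _; lia.
have [A [s' [pr' sc_le leA _]]] := IHk (ltnW ltk).
have [|||A' [s2 [pr2 sc2_le ltA']]] := @progress_stage k.+1 A s' _ pr'.
- by rewrite ltk.
- by move=> x /sc_le/leqW.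
- rewrite (_ : [set x in linked s' | _] = set0) ?cards0 ?subSS //.
  apply/setP => x; rewrite in_set in_set0;
    apply/negP => /andP[/sc_le + /eqP scx].
  by rewrite scx ltnn.
exists A', s2; split=> //; apply: leq_trans (ltnW ltA') _; exact: leq_pmull.
Qed.

Variable cA : V -> nat.
Hypothesis A0_extendable : extendable e D m A0 cA.
Hypothesis cA_leq2 : forall v, cA v <= 2.
Hypothesis A0_dominating :
  forall Y : {set V}, #|Y| <= m -> #|Y| <= #|nb e Y :&: A0|.

Let r_lt : r + 4 < D.
Proof. by apply: leq_trans D_large; rewrite -addn1 leq_add2l ltnW. Qed.

Lemma progress_core : exists s, progress A0 s /\ linked s = set0.
Proof.
have room_core : room V D m (#|core P| + #|A0|).
  have disC := disjoint_tips (fun x => @tip_notin_core _ _ P x).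
  by apply: leq_room (room_missing disC (subxx _)); exact: leq_addr.
have [|s0 [fs0 dom0]] :=
  feasible_root t m_gt0 join card_UV r_lt A0_extendable cA_leq2.
  by apply: leq_room room_core; exact: leq_addl.
have [|s [fs domE _]] := feasible_fill m_gt0 join card_children r_lt fs0 _
    (core_ancestral P) room_core.
  by rewrite dom0 sub1set; case: (core_ancestral P).
exists s; split.
  split=> //; rewrite ?domE //.
  - by move=> x /setDP[xP _]; exact: disjoint_core_interior.
  - exact: tip_notin_core.
  - by rewrite setDv sub0set.
apply/setP => x; rewrite !inE domE; case: (boolP (x \in places P)) => //= xP.
by have /disjointFl -> := disjoint_core_interior xP; rewrite ?foot_interior.
Qed.

Lemma spanning_embedding : exists F, embedding t e setT F.
Proof.
have [s0 [pr0 linked0]] := progress_core.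
have [s1 [fs1 _ _ tip1 [_ cover]]] := progress_complete pr0 linked0.
set L := tip @: places P.
have LP u : u \in L -> exists2 x, x \in places P & u = tip x.
  by case/imsetP => x xP ->; exists x.
have rootL : root \notin L.
  apply/negP => /LP[x xP rE]; case/negP: (tip_notin_core xP).
  by rewrite -rE; case: (core_ancestral P).
have parentL u : u != root -> parent u \notin L.
  by move=> ur; apply/negP => /LP[x xP] /eqP; apply/negP; exact: ppath_leaf.
have [|||s [fs domE [_ agr]]] :=
    feasible_fill (X := ~: L) m_gt0 join card_children r_lt fs1.
- by rewrite -disjoints_subset; exact: disjoint_tips.
- by split=> [|u _ ur]; rewrite inE ?parentL.
- have disL : [disjoint ~: L & L]
    by rewrite disjoint_sym disjoints_subset setCK.
  by apply: leq_room (room_missing disL (sub0set _)); exact: leq_addr.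
case: fs => em _ ext loadX _; rewrite domE in em loadX;
  rewrite setU0 /occupied domE in ext.
apply: (embedding_complete e_sym join card_UV rootL parentL _ em ext _ _
  A0_dominating).
- move=> _ _ /LP[x xP ->] /LP[x' x'P ->]; rewrite !parent_tip //.
  by move/(foot_inj xP x'P) ->.
- move=> u uL; apply: leq_ltn_trans (loadX (parent u) _) (leq_ltn_trans _ r_lt).
    by rewrite inE parentL //; apply: contraTneq uL => ->.
  rewrite addnC leq_add2r; apply: leq_trans (card_children (parent u)).
  exact/subset_leq_card/subsetIl.
apply/subsetP => a; rewrite -[A0]setD0 => /(subsetP cover)/imsetP[x].
rewrite inE => /andP[xP xD] ->; apply/imsetP; exists (tip x);
  first exact: imset_f.
by rewrite parent_tip // agr.
Qed.

End Linking.

(** * Disjoint vertical paths *)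

Lemma geometric_tail (g beta S s : nat) : 2 * beta <= g -> s <= S ->
  \sum_(s <= j < S.+1) g ^ (S.+1 - j) * beta ^ j <=
    2 * (g ^ (S.+1 - s) * beta ^ s).
Proof.
move=> le_g; have [k] := ubnP (S - s); elim: k => // k IHk in s *.
rewrite ltnS => le_k le_s; rewrite big_ltn //.
have [->|ltS] := eqVneq s S; first by rewrite big_geq // addn0 leq_pmull.
have lt_s : s < S by rewrite ltn_neqAle ltS.
rewrite mul2n -addnn leq_add2l; apply: leq_trans (IHk s.+1 _ lt_s) _;
  first by lia.
rewrite subSS subSn // [g ^ (S - s).+1]expnSr [beta ^ s.+1]expnS mulnCA
  [2 * _]mulnCA.
by rewrite -mulnA leq_mul2l mulnCA mulnA leq_mul2r le_g !orbT.
Qed.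

Section DisjointFamily.

Variables (I : finType) (cand : nat -> {set I}) (reg : nat -> I -> {set I}).
Variable w : nat -> nat.
Hypothesis reg_refl : forall s x, x \in cand s -> x \in reg s x.
Hypothesis card_reg : forall s x, x \in cand s -> #|reg s x| <= w s.
Hypothesis card_conflicts : forall s z,
  #|[set x in cand s | z \in reg s x]| <= w s.

Definition disjoint_family (P : {set I}) (sc : I -> nat) : Prop :=
  {in P, forall x, x \in cand (sc x)} /\
  {in P &, forall x x' z, z \in reg (sc x) x -> z \in reg (sc x') x' -> x = x'}.

Lemma disjoint_candidate s (X : {set I}) : #|X| * w s < #|cand s| ->
  exists2 x, x \in cand s & {in X, forall z, z \notin reg s x}.
Proof.
move=> ltX; pose Y := \bigcup_(z in X) [set x in cand s | z \in reg s x].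
have leY : #|Y| <= #|X| * w s by apply: leq_card_bigcup => z _.
have /subsetPn[x xc xY] : ~~ (cand s \subset Y).
  by apply: contraL ltX => /subset_leq_card leC;
    rewrite -leqNgt (leq_trans leC).
exists x => // z zX; apply: contra xY => zx.
by apply/bigcupP; exists z; rewrite // inE xc.
Qed.

Lemma card_covered S (P : {set I}) sc :
  disjoint_family P sc -> {in P, forall x, sc x <= S} ->
  #|\bigcup_(x in P) reg (sc x) x| <=
  \sum_(0 <= j < S.+1) #|[set x in P | sc x == j]| * w j.
Proof.
move=> [candP _] le_sc; have regP x : x \in P -> #|reg (sc x) x| <= w (sc x).
  by move/candP/card_reg.
apply: leq_trans (leq_card_bigcup_sum regP) _; apply: eq_leq.
rewrite (partition_big (fun x => inord (sc x) : 'I_S.+1) predT) //= big_mkord.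
apply: eq_bigr => j _; rewrite -sum_nat_const; apply: congr_big => // x.
  by rewrite inE; case: (boolP (x \in P)) => //= /le_sc le_x;
    rewrite -val_eqE /= inordK.
by case/andP => xP /eqP <-; rewrite inordK // ltnS le_sc.
Qed.

Lemma disjoint_family_add s (P : {set I}) sc :
  disjoint_family P sc -> #|\bigcup_(x in P) reg (sc x) x| * w s < #|cand s| ->
  exists x sc', [/\ disjoint_family (x |: P) sc', x \notin P, sc' x = s &
    {in P, sc' =1 sc}].
Proof.
move=> [candP disP] /disjoint_candidate[x xs xfree].
have free x' z : x' \in P -> z \in reg s x -> z \in reg (sc x') x' -> False.
  move=> x'P zx zx'; have zP : z \in \bigcup_(x in P) reg (sc x) x.
    by apply/bigcupP; exists x'.
  by rewrite (negPf (xfree z zP)) in zx.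
have xP : x \notin P.
  by apply/negP => xP; apply: (free x x xP); apply: reg_refl; rewrite // candP.
pose sc' z := if z == x then s else sc z.
have sc'x : sc' x = s by rewrite /sc' eqxx.
have sc'P : {in P, sc' =1 sc}.
  by move=> z zP; rewrite /sc'; case: eqVneq zP xP => // -> ->.
exists x, sc'; split=> //; split.
  by move=> z /setU1P[->|zP]; rewrite ?sc'x ?sc'P ?candP.
move=> z z' /setU1P[->|zP] /setU1P[->|z'P] // v; rewrite ?sc'x ?sc'P //.
- by move=> vx vz'; case: (free z' v).
- by move=> vz vx; case: (free z v).
- exact: disP.
Qed.

Lemma disjoint_family_request S s (M : nat -> nat) (P : {set I}) sc :
  disjoint_family P sc -> {in P, forall x, sc x <= S} ->
  (forall j, j <= S -> #|[set x in P | sc x == j]| = M j) ->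
  s <= S -> (forall j, j < s -> M j = 0) ->
  (\sum_(s <= j < S.+1) M j * w j) * w s < #|cand s| ->
  exists P' sc', [/\ disjoint_family P' sc', {in P', forall x, sc' x <= S} &
    forall j, j <= S -> #|[set x in P' | sc' x == j]| = M j + (j == s)].
Proof.
move=> famP le_sc cnt le_s M0 room_s.
have [|x [sc' [fam' xP sc'x sc'P]]] := @disjoint_family_add s P sc famP.
  apply: leq_ltn_trans room_s; rewrite leq_mul2r; apply/orP; right.
  apply: leq_trans (card_covered famP le_sc) _.
  rewrite (big_cat_nat (n := s)) ?leqW //= big1_seq ?add0n => [|j]; last first.
    rewrite mem_index_iota => /andP[_ lt_j].
    by rewrite cnt ?M0 // (leq_trans (ltnW lt_j)).
  rewrite big_nat_cond [X in _ <= X]big_nat_cond; apply: leq_sum => j.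
  by rewrite andbT ltnS => /andP[_ le_j]; rewrite cnt.
exists (x |: P), sc'; split=> //.
  by move=> z /setU1P[->|zP]; rewrite ?sc'x // sc'P // le_sc.
move=> j le_j; rewrite -cnt // (cardsD1 x) !inE eqxx sc'x eq_sym addnC.
congr (_ + _); apply: eq_card => z; rewrite !inE.
have [->|_] := eqVneq z x; first by rewrite (negPf xP).
by case: (boolP (z \in P)) => //= /sc'P->.
Qed.

(* The requests are served by decreasing scale, so that the new place of scale
   [s] only has to avoid the places of scale at least [s]. *)
Lemma disjoint_family_exists S (M : nat -> nat) :
  (forall s, s <= S -> 0 < M s ->
    (\sum_(s <= j < S.+1) M j * w j) * w s < #|cand s|) ->
  exists P sc, [/\ disjoint_family P sc, {in P, forall x, sc x <= S} &
    forall s, s <= S -> #|[set x in P | sc x == s]| = M s].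
Proof.
have [k] := ubnP (\sum_(0 <= j < S.+1) M j); elim: k => // k IHk in M *.
rewrite ltnS => le_k room_M.
have [/existsP[j0 Mj0]|] := boolP [exists j : 'I_S.+1, 0 < M j]; last first.
  rewrite negb_exists => /forallP M0; exists set0, (fun=> 0); split.
  - by split=> [x|x x']; rewrite inE.
  - by move=> x; rewrite inE.
  - move=> s le_s; have := M0 (Ordinal (le_s : s < S.+1)).
    rewrite -eqn0Ngt => /eqP ->.
    by apply: eq_card0 => x; rewrite !inE.
have exM : exists s, (s <= S) && (0 < M s).
  by exists j0; rewrite -ltnS ltn_ord.
case: (ex_minnP exM) => s /andP[le_s Ms] min_s.
pose M' j := M j - (j == s).
have M'E j : M j = M' j + (j == s).
  by rewrite /M'; case: eqVneq => [->|_]; rewrite ?subnK // subn0 addn0.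
have room_M' s' : s' <= S -> 0 < M s' ->
    (\sum_(s' <= j < S.+1) M' j * w j) * w s' < #|cand s'|.
  move=> le_s' Ms'; apply: leq_ltn_trans (room_M s' le_s' Ms').
  rewrite leq_mul2r; apply/orP; right; apply: leq_sum => j _.
  by rewrite leq_mul2r leq_subr orbT.
have [||P [sc [famP le_sc cnt]]] := IHk M'.
- move: le_k; rewrite (eq_bigr _ (fun j _ => M'E j)) big_split /=.
  rewrite [X in _ + X](bigD1_seq s) ?mem_index_iota ?iota_uniq //= eqxx.
  by lia.
- by move=> s' le_s' M's'; apply: room_M' => //; rewrite M'E addn_gt0 M's'.
have [|P' [sc' [famP' le_sc' cnt']]] :=
    disjoint_family_request famP le_sc cnt le_s _ (room_M' s le_s Ms).
  move=> j lt_j; have := min_s j; rewrite M'E (ltn_eqF lt_j) addn0.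
  by rewrite (leq_trans (ltnW lt_j) le_s) lt0n; case: eqP => // _ /(_ isT); lia.
by exists P', sc'; split=> // j le_j; rewrite M'E cnt'.
Qed.

End DisjointFamily.

Section VerticalPaths.

Variables (U : finType) (t : rooted_tree U).

Local Notation root := (tree_root t).
Local Notation parent := (parent t).
Local Notation depth := (depth t).
Local Notation below := (below t).
Local Notation subtree := (subtree t).

(* The vertical path of length [h] that ends in [x], with everything that hangs
   from it except below [x]. *)
Definition segment (h : nat) (x : U) : {set U} :=
  [set v | below v (iter h parent x) && (~~ below v x || (v == x))].

Definition thin_ends (h B : nat) : {set U} :=
  [set x | (h <= depth x) &&
    (#|subtree (iter h parent x)| <= #|subtree x| + B)].

Lemma thin_ends_depth h B x : x \in thin_ends h B -> h <= depth x.
Proof. by rewrite inE => /andP[]. Qed.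

Lemma segment_end h x : h <= depth x -> x \in segment h x.
Proof. by move=> hx; rewrite inE below_iter //= eqxx orbT. Qed.

Lemma card_segment h x : h <= depth x ->
  #|segment h x| + #|subtree x| = #|subtree (iter h parent x)|.+1.
Proof.
move=> hx; have xt := below_iter hx.
have -> : segment h x = x |: (subtree (iter h parent x) :\: subtree x).
  apply/setP => v; rewrite !inE; case: eqVneq => [->|_] /=.
    by rewrite xt orbT.
  by rewrite orbF andbC.
rewrite cardsU1 !inE below_refl /=
  -(cardsID (subtree x) (subtree (iter h parent x))).
rewrite (setIidPr _); first by lia.
by apply/subsetP => v; rewrite !inE => vx; exact: below_trans vx xt.
Qed.

Lemma segment_iter h x z i : z \in segment h x ->
  i <= depth z - depth (iter h parent x) -> iter i parent z \in segment h x.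
Proof.
rewrite !inE => /andP[zt zx] le_i; have dz := leq_below_depth zt.
have iz : i <= depth z by lia.
have zi := below_iter iz.
apply/andP; split.
  by apply: below_chain zi zt _; rewrite (depth_iter iz); lia.
case: (boolP (below (iter i parent z) x)) => //= ix.
have zbx := below_trans zi ix; rewrite zbx /= in zx.
rewrite (eqP zx) in ix iz *; apply/eqP; apply: below_eq ix _.
by rewrite depth_iter // leq_subr.
Qed.

Variable b : nat.
Hypothesis card_children : forall u, #|children t u| <= b.
Hypothesis b_gt1 : 1 < b.

Lemma card_thin_ends_through h B z :
  #|[set x in thin_ends h B | z \in segment h x]| <= B.+1 * b ^ h.
Proof.
rewrite -[B.+1]card_ord -cardsT.
apply: leq_trans (leq_card_bigcup (k := b ^ h)
  (F := fun i : 'I_B.+1 => generation t h (iter i parent z)) _);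
  last by move=> i _; exact: card_generation.
apply/subset_leq_card/subsetP => x; rewrite !inE => /andP[/andP[hx szx] zR].
have zt : below z (iter h parent x) by case/andP: zR.
pose i := depth z - depth (iter h parent x).
have iE : iter i parent z = iter h parent x by case/andP: zt => _ /eqP.
have iz : i <= depth z := leq_subr _ _.
have iB : i < B.+1.
  have inj : {in gtn i.+1 &, injective (fun j => iter j parent z)}.
    move=> j k; rewrite !inE !ltnS => ji ki E.
    by have := congr1 depth E;
      rewrite !depth_iter ?(leq_trans ji) ?(leq_trans ki) //; lia.
  have uq : uniq (mkseq (fun j => iter j parent z) i.+1) by apply/mkseq_uniqP.
  have : size (mkseq (fun j => iter j parent z) i.+1) <= #|segment h x|.
    rewrite -(card_uniqP uq); apply/subset_leq_card/subsetP => v.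
    case/mapP => j; rewrite mem_iota add0n ltnS => ji ->.
    by apply: segment_iter; rewrite // inE.
  by rewrite size_mkseq; have := card_segment hx; lia.
apply/bigcupP; exists (Ordinal iB); first by rewrite inE.
by rewrite inE hx /= iE eqxx.
Qed.

Section Counting.

Variable h : nat.

Let B := b ^ h.+1.

Definition heavy : {set U} := [set v | B < #|subtree v|].

Definition heavy_children (v : U) : {set U} := children t v :&: heavy.

Definition branching : {set U} := [set v | 1 < #|heavy_children v|].

Definition lowest_heavy : {set U} :=
  [set v in heavy | heavy_children v == set0].

Definition light_ends : {set U} :=
  [set x | (h <= depth x) && (#|subtree (iter h parent x)| <= B)].

Definition unbranched_ends : {set U} :=
  [set x in heavy | (h <= depth x) &&
    [forall i : 'I_h, iter i.+1 parent x \notin branching]].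

Lemma heavy_above u v : u \in heavy -> below u v -> v \in heavy.
Proof. by rewrite !inE => ltB /leq_card_subtree; exact: leq_trans. Qed.

Lemma light_below_lowest v x : v \in lowest_heavy -> below x v -> x != v ->
  x \notin heavy.
Proof.
rewrite inE => /andP[_ /eqP/setP noH] /belowP[[|i] lti vE] xv.
  by rewrite vE eqxx in xv.
apply/negP => xH; have := noH (iter i parent x).
rewrite inE (heavy_above xH (below_iter (ltnW lti))) andbT childrenE -iterS
  -vE eqxx.
by rewrite andbT in_set0 depth_gt0 // depth_iter ?subn_gt0 // ltnW.
Qed.

(* A lowest heavy vertex has more than [b ^ h.+1] vertices below it, hence one
   at depth more than [h] below it. *)
Lemma card_lowest_heavy : #|lowest_heavy| <= #|light_ends|.
Proof.
pose g v := odflt v [pick x in light_ends | below x v].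
have gP v : v \in lowest_heavy -> g v \in light_ends /\ below (g v) v.
  move=> vL; rewrite /g; case: pickP => [x /andP[]//|none].
  suff : #|subtree v| <= B by move: vL; rewrite !inE ltnNge => /andP[/negPf->].
  apply: leq_trans (card_generations card_children b_gt1 h.+1 v).
  apply/subset_leq_card/subsetP => x; rewrite !inE => xv; rewrite xv ltnNge.
  apply/negP => dx; have hx : h <= depth x by lia.
  suff : (x \in light_ends) && below x v by rewrite none.
  rewrite inE hx xv andbT /= leqNgt.
  have xhv : below (iter h parent x) v.
    by apply: below_chain (below_iter hx) xv _; rewrite depth_iter //; lia.
  have : iter h parent x \notin heavy.
    apply: light_below_lowest vL xhv _; apply/eqP => E.
    by have := congr1 depth E; rewrite depth_iter //; lia.
  by rewrite inE.
have g_inj : {in lowest_heavy &, injective g}.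
  move=> v v' vL v'L E; have [_ gv] := gP v vL; have [_ gv'] := gP v' v'L.
  rewrite -E in gv'.
  wlog le : v v' vL v'L gv gv' E / depth v' <= depth v.
    move=> wlog_le; case: (leqP (depth v') (depth v)) => [|/ltnW];
      first exact: wlog_le.
    by move=> le; apply/esym; apply: wlog_le => //; rewrite -E.
  apply/eqP; apply: contraT => nv.
  have := light_below_lowest v'L (below_chain gv gv' le) nv.
  by move: vL; rewrite inE => /andP[->].
rewrite -(card_in_imset g_inj);
  apply/subset_leq_card/subsetP => _ /imsetP[v vL ->].
by have [] := gP v vL.
Qed.

Lemma card_branching : #|branching| <= #|lowest_heavy|.
Proof.
have hcH v : 0 < #|heavy_children v| -> v \in heavy.
  case/card_gt0P => w; rewrite inE childrenE => /andP[/andP[wr /eqP<-] wH].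
  exact: heavy_above wH (below_parent wr).
have sum_hc : \sum_(v in heavy) #|heavy_children v| <= #|heavy|.
  rewrite (eq_bigr (fun v => #|fibre parent (heavy :\ root) v|)) => [|v _].
    rewrite -card_fibres; apply/subset_leq_card/subsetP => w.
    by rewrite !inE -andbA => /and3P[].
  by apply: eq_card => w; rewrite !inE; case: (w != root);
    rewrite ?andbF //= andbC.
have sub_heavyE (X : {set U}) : X \subset heavy ->
  #|X| = \sum_(v in heavy) (v \in X : nat).
  by move=> sX; rewrite sum_mem_setI (setIidPr sX).
have : #|heavy| + #|branching| <=
  \sum_(v in heavy) #|heavy_children v| + #|lowest_heavy|.
  rewrite (sub_heavyE heavy) // (sub_heavyE branching); last first.
    by apply/subsetP => v; rewrite inE => lt1; apply: hcH; exact: ltnW.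
  rewrite (sub_heavyE lowest_heavy);
    last by apply/subsetP => v; rewrite inE => /andP[].
  rewrite -!big_split /=; apply: leq_sum => v vH;
    rewrite vH [v \in branching]inE.
  rewrite [v \in lowest_heavy]inE vH -cards_eq0 /=.
  by case: #|heavy_children v| => [|[|k]].
by lia.
Qed.

Lemma leq_card_shallow (X Y Z : {set U}) :
  (forall x, x \in X -> h <= depth x -> x \in Y :|: Z) ->
  #|X| <= #|Y| + b ^ h + #|Z|.
Proof.
move=> XYZ; apply: (@leq_trans #|Y :|: generations t h root :|: Z|).
  apply/subset_leq_card/subsetP => x xX; have [ltx|lex] := ltnP (depth x) h.
    by rewrite !in_setU [x \in generations _ _ _]inE below_root depth_root
      ltx orbT.
  by have := XYZ x xX lex; rewrite !inE => /orP[->|->]; rewrite ?orbT.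
apply: leq_trans (leq_card_setU _ _) _; rewrite leq_add2r.
apply: leq_trans (leq_card_setU _ _) _; rewrite leq_add2l.
exact: card_generations.
Qed.

Lemma card_heavy : #|heavy| <=
  #|unbranched_ends| + b ^ h + #|branching| * b ^ h.+1.
Proof.
have := leq_card_bigcup (fun u (_ : u \in branching) =>
  card_generations card_children b_gt1 h.+1 u).
rewrite -(leq_add2l (#|unbranched_ends| + b ^ h)); apply: leq_trans.
apply: leq_card_shallow => x xH lex; rewrite inE.
case: (boolP [forall i : 'I_h, iter i.+1 parent x \notin branching]) => [good|].
  by rewrite [x \in unbranched_ends]inE xH lex good.
case/forallPn => i; rewrite negbK => iB.
have ix : i.+1 <= depth x by apply: leq_trans (ltn_ord i) lex.
apply/orP; right; apply/bigcupP; exists (iter i.+1 parent x) => //.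
rewrite inE below_iter // depth_iter //=.
by have := ltn_ord i; lia.
Qed.

Lemma card_all_ends : #|U| <= #|light_ends| + b ^ h + #|heavy| * b ^ h.
Proof.
have := leq_card_bigcup (fun u (_ : u \in heavy) =>
  card_generation card_children h u).
rewrite -(leq_add2l (#|light_ends| + b ^ h)) -cardsT; apply: leq_trans.
apply: leq_card_shallow => x _ lex; rewrite inE.
have [lez|ltz] := leqP #|subtree (iter h parent x)| B.
  by rewrite [x \in light_ends]inE lex lez.
apply/orP; right; apply/bigcupP; exists (iter h parent x); first by rewrite inE.
by rewrite inE lex eqxx.
Qed.

Lemma subtree_unbranched x : x \in unbranched_ends ->
  #|subtree (iter h parent x)| <= #|subtree x| + h * (1 + b * B).
Proof.
rewrite inE => /and3P[xH hx /forallP noB].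
suff bound i : i <= h -> #|subtree (iter i parent x)| <=
  #|subtree x| + i * (1 + b * B).
  exact: bound (leqnn h).
elim: i => [|i IHi] lti; first by rewrite mul0n addn0.
have lt_ix : i < depth x := leq_trans lti hx.
have wr : iter i parent x != root.
  by apply: depth_gt0; rewrite depth_iter ?subn_gt0 // ltnW.
have wH : iter i parent x \in heavy := heavy_above xH (below_iter (ltnW lt_ix)).
rewrite mulSn addnCA; apply: leq_trans _ (leq_add (leqnn _) (IHi (ltnW lti))).
rewrite addnC; apply: card_subtree_child => // w' w'r pw' w'w.
have := noB (Ordinal lti); rewrite inE -leqNgt /= => le1.
rewrite leqNgt; apply: contraL le1 => w'H; rewrite -ltnNge.
apply: (@leq_trans #|[set w'; iter i parent x]|); first by rewrite cards2 w'w.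
apply/subset_leq_card/subsetP => z /set2P[->|->]; rewrite inE childrenE.
  by rewrite w'r pw' eqxx inE.
by rewrite wr eqxx.
Qed.

End Counting.

Lemma leq_length_mul_expn h : h * (1 + b * b ^ h.+1) <= b ^ (2 * h + 3).
Proof.
have -> : b ^ (2 * h + 3) = b ^ h * (b * (b * b ^ h.+1)).
  by rewrite -!expnS -expnD; congr (_ ^ _); lia.
apply: leq_mul; first by apply: ltnW; exact: ltn_expl.
have : 0 < b * b ^ h.+1 by rewrite muln_gt0 expn_gt0 ltnW.
by move: (b * _) => q q_gt0; nia.
Qed.

Lemma leq_level_count K q n : 0 < q -> 2 * (b ^ 3 * (q * q)) <= n ->
  n <= K + q + (K + q + K * (b * q)) * q -> n <= K * (b ^ 4 * (q * q)).
Proof.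
move=> q_gt0 n_large le_n; have b3 : 8 <= b ^ 3
  by rewrite -[8]/(2 ^ 3) leq_exp2r.
have qq : q <= q * q by rewrite leq_pmulr.
case: K => [|K] in le_n *.
  have : 8 * (q * q) <= b ^ 3 * (q * q) by rewrite leq_mul2r b3 orbT.
  by move: le_n; rewrite !mul0n !add0n addn0; lia.
have le1 : n <= K.+1 * (4 * (q * q) + b * (q * q)) by nia.
apply: leq_trans le1 _; rewrite leq_mul2l -mulnDl leq_mul2r.
suff -> : 4 + b <= b ^ 4 by rewrite !orbT.
by rewrite expnS; move: (b ^ 3) b3 => c c8; nia.
Qed.

Lemma many_thin_ends h : 2 * b ^ (2 * h + 3) <= #|U| ->
  #|U| <= #|thin_ends h (b ^ (2 * h + 3))| * b ^ (2 * h + 4).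
Proof.
move=> U_large; set K := #|thin_ends _ _|.
have le_light : #|light_ends h| <= K.
  apply/subset_leq_card/subsetP => x; rewrite !inE => /andP[-> le] /=.
  apply: leq_trans le (leq_trans _ (leq_addl _ _)).
  by rewrite leq_pexp2l ?(ltnW b_gt1) //; lia.
have le_unbranched : #|unbranched_ends h| <= K.
  apply/subset_leq_card/subsetP => x xu; have le := subtree_unbranched xu.
  move: xu; rewrite !inE => /and3P[_ -> _] /=; apply: leq_trans le _.
  by rewrite leq_add2l leq_length_mul_expn.
have le_branching :=
  leq_trans (card_branching h) (leq_trans (card_lowest_heavy h) le_light).
have le_heavy : #|heavy h| <= K + b ^ h + K * b ^ h.+1.
  apply: leq_trans (card_heavy h) _.
  by rewrite leq_add ?leq_add2r // leq_mul2r le_branching orbT.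
have le_U : #|U| <= K + b ^ h + (K + b ^ h + K * b ^ h.+1) * b ^ h.
  apply: leq_trans (card_all_ends h) _.
  by rewrite leq_add ?leq_add2r // leq_mul2r le_heavy orbT.
have pow3 : b ^ (2 * h + 3) = b ^ 3 * (b ^ h * b ^ h).
  by rewrite -!expnD; congr (_ ^ _); lia.
have pow4 : b ^ (2 * h + 4) = b ^ 4 * (b ^ h * b ^ h).
  by rewrite -!expnD; congr (_ ^ _); lia.
rewrite pow3 in U_large; rewrite expnS in le_U; rewrite pow4.
apply: leq_level_count U_large le_U => //; by rewrite expn_gt0 ltnW.
Qed.

Definition vertical_length (s : nat) : nat := 2 * s + 3.

Definition vertical_family (P : {set U}) (sc : U -> nat) : Prop :=
  {in P, forall x, vertical_length (sc x) <= depth x} /\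
  {in P &, forall x x' z, z \in segment (vertical_length (sc x)) x ->
    z \in segment (vertical_length (sc x')) x' -> x = x'}.

Let ends s := thin_ends (vertical_length s) (b ^ (2 * vertical_length s + 3)).

Let beta := b ^ 19.

Lemma expn_succ_leq k : (b ^ k).+1 <= b ^ k.+1.
Proof. by rewrite ltn_exp2l. Qed.

Lemma card_ends_segment s x : x \in ends s ->
  #|segment (vertical_length s) x| <= b ^ (6 * s + 13).
Proof.
rewrite inE => /andP[hx le]; have := card_segment hx.
have : (b ^ (2 * vertical_length s + 3)).+1 <= b ^ (6 * s + 13).
  apply: leq_trans (expn_succ_leq _) _; rewrite leq_pexp2l ?(ltnW b_gt1) //.
  by rewrite /vertical_length; lia.
by lia.
Qed.

Lemma card_ends_through s z :
  #|[set x in ends s | z \in segment (vertical_length s) x]| <=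
    b ^ (6 * s + 13).
Proof.
apply: leq_trans (card_thin_ends_through _ _ _) _.
apply: leq_trans (leq_mul (expn_succ_leq _) (leqnn _)) _.
by rewrite -expnD leq_pexp2l ?(ltnW b_gt1) // /vertical_length; lia.
Qed.

Lemma leq_weight_beta s : 0 < s -> b ^ (6 * s + 13) <= beta ^ s.
Proof. by move=> s_gt0; rewrite -expnM leq_pexp2l ?(ltnW b_gt1) //; lia. Qed.

Lemma many_ends s : 0 < s -> 2 * beta ^ s <= #|U| ->
  #|U| <= #|ends s| * beta ^ s.
Proof.
move=> s_gt0 U_large.
have le_pow k : k <= 19 * s -> b ^ k <= beta ^ s.
  by move=> le_k; rewrite -expnM leq_pexp2l // ltnW.
apply: leq_trans (many_thin_ends (h := vertical_length s) _) _.
  by apply: leq_trans U_large; rewrite leq_mul2l le_pow // /vertical_length;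
    lia.
by rewrite leq_mul2l le_pow ?orbT // /vertical_length; lia.
Qed.

Lemma ends_room g S quota s : beta ^ 3 <= g -> 0 < quota ->
  2 * quota * g ^ S.+1 < #|U| ->
  0 < s <= S ->
  (\sum_(s <= j < S.+1) quota * g ^ (S.+1 - j) * b ^ (6 * j + 13)) *
    b ^ (6 * s + 13)
    < #|ends s|.
Proof.
move=> le_g quota_gt0 U_large /andP[s_gt0 le_s].
have beta_gt1 : 1 < beta by rewrite -(exp1n 19) ltn_exp2r.
have q_gt0 : 0 < beta ^ s by rewrite expn_gt0 ltnW.
have le_2g : 2 * beta <= g.
  by apply: leq_trans le_g; rewrite expnSr leq_mul2r expnS expn1; nia.
set A := g ^ (S.+1 - s); set q := beta ^ s in q_gt0 *.
have A_gt0 : 0 < A by rewrite expn_gt0; lia.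
have le_sum : \sum_(s <= j < S.+1) quota * g ^ (S.+1 - j) * b ^ (6 * j + 13) <=
    2 * quota * (A * q).
  rewrite -mulnA mulnCA;
    apply: leq_trans (leq_mul (leqnn quota) (geometric_tail le_2g le_s)).
  rewrite big_distrr /= big_nat_cond [X in _ <= X]big_nat_cond.
  apply: leq_sum => j /andP[/andP[le_j _] _]; rewrite -mulnA !leq_mul2l.
  by rewrite leq_weight_beta ?orbT // (leq_trans s_gt0).
have lt_U : 2 * quota * (A * q) * q * q < #|U|.
  apply: leq_ltn_trans U_large; rewrite -!mulnA !leq_mul2l; apply/orP; right.
  rewrite -[in g ^ S.+1](subnK (leqW le_s)) expnD leq_mul2l -!expnD.
  by rewrite addnn -mul2n -mulSn expnM leq_exp2r // le_g !orbT.
have le_U : #|U| <= #|ends s| * q.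
  apply: many_ends => //; apply: leq_trans (ltnW lt_U);
    rewrite -!mulnA leq_mul2l.
  by rewrite !mulnA leq_pmull // !muln_gt0 quota_gt0 A_gt0 q_gt0.
rewrite -(ltn_pmul2r q_gt0); apply: leq_trans le_U; apply: leq_ltn_trans lt_U.
by rewrite leq_mul2r; apply/orP; right; apply: leq_mul => //;
  exact: leq_weight_beta.
Qed.

Lemma vertical_family_exists g S quota : beta ^ 3 <= g -> 0 < quota ->
  2 * quota * g ^ S.+1 < #|U| ->
  exists P sc, vertical_family P sc /\
    forall s, 0 < s <= S -> #|[set x in P | sc x == s]| =
      quota * g ^ (S.+1 - s).
Proof.
move=> le_g quota_gt0 U_large; pose M s := (0 < s) * (quota * g ^ (S.+1 - s)).
have [|||s le_s Ms|P [sc [[endP disP] _ cnt]]] :=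
    @disjoint_family_exists _ ends (fun s => segment (vertical_length s))
      (fun s => b ^ (6 * s + 13)) _ _ _ S M.
- by move=> s x /thin_ends_depth; exact: segment_end.
- exact: card_ends_segment.
- exact: card_ends_through.
- have s_gt0 : 0 < s by case: s Ms {le_s}.
  have := ends_room le_g quota_gt0 U_large (_ : 0 < s <= S); rewrite s_gt0 le_s.
  move=> /(_ isT); congr (_ * _ < _); apply: eq_big_nat => j /andP[le_j _].
  by rewrite /M (leq_trans s_gt0 le_j) mul1n.
exists P, sc; split; first by split=> // x /endP/thin_ends_depth.
by move=> s /andP[s_gt0 le_s]; rewrite cnt // /M s_gt0 mul1n.
Qed.

End VerticalPaths.

(** * The zigzag tree *)

Section Zigzag.

Variables (U : finType) (t : rooted_tree U) (P : {set U}) (sc : U -> nat).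
Hypothesis fam : vertical_family t P sc.

Local Notation root := (tree_root t).
Local Notation parent := (parent t).
Local Notation depth := (depth t).
Local Notation below := (below t).
Local Notation len x := (vertical_length (sc x)).
Local Notation seg x := (segment t (len x) x).

Lemma vertical_length_gt0 s : 0 < vertical_length s.
Proof. by rewrite addn_gt0 orbT. Qed.

Definition vpath (x : U) (i : nat) : U := iter (len x - i) parent x.

Lemma depth_vpath x i : x \in P -> i <= len x ->
  depth (vpath x i) = depth (vpath x 0) + i.
Proof.
move=> xP le_i; have hx := (proj1 fam) x xP.
by rewrite /vpath subn0 !depth_iter //; lia.
Qed.

Lemma parent_vpath x i : i < len x -> parent (vpath x i.+1) = vpath x i.
Proof. by move=> lt_i; rewrite /vpath -iterS subnSK. Qed.

Lemma vpath_end x : vpath x (len x) = x.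
Proof. by rewrite /vpath subnn. Qed.

Lemma depth_vpath_end x : x \in P -> depth x = depth (vpath x 0) + len x.
Proof. by move=> xP; rewrite -(depth_vpath xP (leqnn _)) vpath_end. Qed.

Lemma vpath_segment x i : x \in P -> i <= len x -> vpath x i \in seg x.
Proof.
move=> xP le_i; have hx := (proj1 fam) x xP.
apply: segment_iter; first exact: segment_end.
by rewrite depth_iter // subKn // leq_subr.
Qed.

Lemma vpath_neq_root x i : x \in P -> 0 < i <= len x -> vpath x i != root.
Proof.
move=> xP /andP[i0 le_i]; apply: depth_gt0; rewrite depth_vpath //.
by rewrite (leq_trans i0) // leq_addl.
Qed.

Lemma segment_inj x x' v : x \in P -> x' \in P -> v \in seg x ->
  v \in seg x' -> x = x'.
Proof. by move=> xP x'P; exact: (proj2 fam). Qed.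

Lemma vpath_inj x x' i j : x \in P -> x' \in P -> i <= len x -> j <= len x' ->
  vpath x i = vpath x' j -> x = x' /\ i = j.
Proof.
move=> xP x'P le_i le_j E.
have xx' : x = x'.
  by apply: (segment_inj xP x'P (vpath_segment xP le_i));
    rewrite E vpath_segment.
rewrite -xx' in E le_j *; split=> //; have := congr1 depth E.
by rewrite (depth_vpath xP le_i) (depth_vpath xP le_j) => /addnI.
Qed.

Lemma below_vpath x i j : x \in P -> i <= j <= len x ->
  below (vpath x j) (vpath x i).
Proof.
move=> xP /andP[ij le_j]; have hx := (proj1 fam) x xP.
have -> : vpath x i = iter (j - i) parent (vpath x j).
  by rewrite /vpath -iterD; congr iter; lia.
by apply: below_iter; rewrite depth_vpath //; lia.
Qed.

Lemma below_segment x v : below v (vpath x 0) -> ~~ below v x -> v \in seg x.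
Proof.
by move=> v0 vx; rewrite inE vx andbT; move: v0; rewrite /vpath subn0.
Qed.

Lemma depth_mid_child x v : x \in P -> v \in children t (vpath x (sc x).+1) ->
  depth v = depth (vpath x 0) + (sc x).+2.
Proof.
move=> xP; rewrite childrenE => /andP[vr /eqP pv].
by rewrite depth_parent // pv depth_vpath ?addnS // /vertical_length; lia.
Qed.

Lemma mid_child_segment x v : x \in P -> v \in children t (vpath x (sc x).+1) ->
  v \in seg x.
Proof.
move=> xP vmid; have dv := depth_mid_child xP vmid; apply: below_segment.
  move: vmid; rewrite childrenE => /andP[vr /eqP pv].
  apply: below_trans (below_parent vr) _; rewrite pv below_vpath //.
  by rewrite /vertical_length; lia.
apply/negP => /leq_below_depth;
  rewrite (depth_vpath_end xP) dv /vertical_length.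
by lia.
Qed.

(* The path [p_0 p_1 ... p_h], [h = 2 s + 3], is rewired to the pendant path
   [p_0 p_(h-1) p_1 p_(h-2) p_2 ...], which ends with [p_(s+2) p_(s+1)]; the
   bottom vertex [p_h] hangs from [p_0], as [h - (h + 1)] is truncated to [0],
   and the remaining children of [p_(s+1)] hang from [p_(s+2)], so that
   [p_(s+1)] becomes a leaf. *)
Definition zindex (x : U) (i : nat) : nat :=
  if i <= (sc x).+1 then len x - i else len x - i.+1.

Definition rewired (x v : U) : bool :=
  [exists i : 'I_(len x), v == vpath x i.+1] ||
  (v \in children t (vpath x (sc x).+1)).

Definition rewired_parent (x v : U) : U :=
  let i := depth v - depth (vpath x 0) in
  if v == vpath x i then vpath x (zindex x i) else vpath x (sc x).+2.

Definition zparent (v : U) : U :=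
  if [pick x in P | rewired x v] is Some x then rewired_parent x v
  else parent v.

Lemma rewired_segment x v : x \in P -> rewired x v -> v \in seg x.
Proof.
move=> xP /orP[/existsP[i /eqP->]|]; last exact: mid_child_segment.
exact: vpath_segment.
Qed.

Lemma zparent_rewired x v : x \in P -> rewired x v ->
  zparent v = rewired_parent x v.
Proof.
move=> xP hx; rewrite /zparent; case: pickP => [x' /andP[x'P hx']|/(_ x)].
  by rewrite (segment_inj xP x'P (rewired_segment xP hx)
    (rewired_segment x'P hx')).
by rewrite xP hx.
Qed.

Lemma rewired_vpath x i : 0 < i <= len x -> rewired x (vpath x i).
Proof.
case: i => // i lti; apply/orP; left.
by apply/existsP; exists (Ordinal lti).
Qed.

Lemma zparent_vpath x i : x \in P -> 0 < i <= len x ->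
  zparent (vpath x i) = vpath x (zindex x i).
Proof.
move=> xP i_range; rewrite (zparent_rewired xP) ?rewired_vpath //.
by rewrite /rewired_parent depth_vpath ?addKn ?eqxx //; case/andP: i_range.
Qed.

Lemma zparent_mid_child x v : x \in P -> v \in children t (vpath x (sc x).+1) ->
  v != vpath x (sc x).+2 -> zparent v = vpath x (sc x).+2.
Proof.
move=> xP vmid vn; rewrite (zparent_rewired xP);
  last by rewrite /rewired vmid orbT.
by rewrite /rewired_parent (depth_mid_child xP vmid) addKn (negPf vn).
Qed.

Variant zparent_spec v : U -> Prop :=
  | ZparentPath x i of x \in P & 0 < i <= len x & v = vpath x i :
      zparent_spec v (vpath x (zindex x i))
  | ZparentMid x of x \in P & v \in children t (vpath x (sc x).+1) &
      v != vpath x (sc x).+2 : zparent_spec v (vpath x (sc x).+2)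
  | ZparentOther of {in P, forall x, ~~ rewired x v} :
    zparent_spec v (parent v).

Lemma zparentP v : zparent_spec v (zparent v).
Proof.
case: (boolP [exists x in P, rewired x v]); last first.
  rewrite negb_exists_in => /forall_inP none.
  have -> : zparent v = parent v; last exact: ZparentOther.
  rewrite /zparent; case: pickP => // x /andP[xP hx].
  by rewrite (negPf (none x xP)) in hx.
case/exists_inP => x xP /orP[/existsP[i /eqP->]|vmid].
  have i_range : 0 < i.+1 <= len x by rewrite /= ltn_ord.
  by rewrite zparent_vpath //; exact: ZparentPath i_range erefl.
have [->|vn] := eqVneq v (vpath x (sc x).+2).
  have i_range : 0 < (sc x).+2 <= len x by rewrite /vertical_length; lia.
  by rewrite zparent_vpath //; exact: ZparentPath i_range erefl.
by rewrite (zparent_mid_child xP) //; exact: ZparentMid.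
Qed.

Lemma zindex_low x i : i <= (sc x).+1 -> zindex x i = len x - i.
Proof. by rewrite /zindex => ->. Qed.

Lemma zindex_high x i : (sc x).+1 < i -> zindex x i = len x - i.+1.
Proof. by rewrite /zindex ltnNge => /negPf->. Qed.

Lemma zindex_lt x i : 0 < i -> zindex x i < len x.
Proof. by rewrite /zindex /vertical_length; case: ifP; lia. Qed.

Lemma zindex_neq_mid x i : i <= len x -> zindex x i != (sc x).+1.
Proof. by rewrite /zindex /vertical_length; case: ifP; lia. Qed.

Definition zpos (x : U) (j : nat) : nat :=
  if odd j then len x - j./2.+1 else j./2.

Definition zigzag (x : U) (j : nat) : U := vpath x (zpos x j).

Lemma zpos_range x j : j <= (sc x).*2.+1 -> 0 < zpos x j.+1 < len x.
Proof. by rewrite /zpos /vertical_length; case: ifP; lia. Qed.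

Lemma zpos_inj x i j : i <= (sc x).*2.+2 -> j <= (sc x).*2.+2 ->
  zpos x i = zpos x j -> i = j.
Proof. by rewrite /zpos /vertical_length; do 2!case: ifP; lia. Qed.

Lemma zpos_surj x i : i < len x -> exists2 j, j <= (sc x).*2.+2 & zpos x j = i.
Proof.
rewrite /vertical_length => lti; have [le_i|gt_i] := leqP i (sc x).+1.
  by exists i.*2; rewrite /zpos ?odd_double ?doubleK; lia.
exists (2 * sc x + 2 - i).*2.+1; first by lia.
by rewrite /zpos /= odd_double /= uphalf_double /vertical_length; lia.
Qed.

Lemma zindex_zpos x j : j <= (sc x).*2.+1 -> zindex x (zpos x j.+1) = zpos x j.
Proof.
rewrite /zindex /zpos /vertical_length /= uphalf_half.
have := odd_double_half j.
by case: (odd j) => /=; case: ifP; lia.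
Qed.

Lemma zparent_zigzag x j : x \in P -> j <= (sc x).*2.+1 ->
  zparent (zigzag x j.+1) = zigzag x j.
Proof.
move=> xP le_j; rewrite /zigzag zparent_vpath // ?zindex_zpos //.
by have /andP[-> /ltnW->] := zpos_range le_j.
Qed.

Lemma zparent_rootward u : exists k, iter k zparent u == root.
Proof.
have rootward_step v : (exists k, iter k zparent (zparent v) == root) ->
    exists k, iter k zparent v == root.
  by case=> k pk; exists k.+1; rewrite iterSr.
have [n] := ubnP (depth u); elim: n => // n IHn in u *; rewrite ltnS => le_n.
have rootward_vpath x i : x \in P -> depth (vpath x 0) < depth u -> i < len x ->
    exists k, iter k zparent (vpath x i) == root.
  move=> xP lt_d /zpos_surj[j le_j <-]; rewrite -/(zigzag x j).
  elim: j le_j => [|j IHj] le_j; first by apply: IHn; exact: leq_trans le_n.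
  by apply: rootward_step; rewrite zparent_zigzag //; apply: IHj; exact: ltnW.
have [->|ur] := eqVneq u root; first by exists 0.
apply: rootward_step.
case: (zparentP u) => [x i xP /andP[i0 le_i] uE|x xP umid _|_].
- have lt_d : depth (vpath x 0) < depth u.
    by rewrite uE (depth_vpath xP le_i); lia.
  exact: rootward_vpath xP lt_d (zindex_lt x i0).
- apply: rootward_vpath; rewrite // ?(depth_mid_child xP umid); first by lia.
  by rewrite /vertical_length; lia.
- by apply: IHn; rewrite -(depth_parent ur).
Qed.

Definition zigzag_tree : rooted_tree U := RootedTree zparent_rootward.

Section Adjacency.

Variables (V : Type) (e : rel V) (f : U -> V).
Hypothesis e_sym : symmetric e.
Hypothesis fE : forall u, u != root -> e (f (zparent u)) (f u).

Lemma vpath_parent_adj x i : x \in P -> 0 < i <= len x ->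
  e (f (vpath x (zindex x i))) (f (vpath x i)).
Proof.
by move=> xP i_range; rewrite -zparent_vpath // fE // vpath_neq_root.
Qed.

Lemma vpath_mirror_adj x i : x \in P -> 0 < i <= len x ->
  e (f (vpath x (len x - i))) (f (vpath x i)).
Proof.
move=> xP i_range; have hE : len x = 2 * sc x + 3 by [].
have [le_mid|gt_mid] := leqP i (sc x).+1.
  by rewrite -zindex_low // vpath_parent_adj.
have [E|ni] := eqVneq i (len x).
  have -> : len x - i = zindex x i by rewrite zindex_high //; lia.
  exact: vpath_parent_adj.
have -> : vpath x i = vpath x (zindex x (len x - i)).
  by rewrite zindex_low ?subKn //; lia.
by rewrite e_sym vpath_parent_adj //; lia.
Qed.

Lemma vpath_shifted_mirror_adj x i : x \in P -> i < len x -> i != (sc x).+1 ->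
  e (f (vpath x (len x - i.+1))) (f (vpath x i)).
Proof.
move=> xP lt_i ni; have hE : len x = 2 * sc x + 3 by [].
have [gt_mid|le_mid] := ltnP (sc x).+1 i.
  by rewrite -zindex_high // vpath_parent_adj //; lia.
have -> : vpath x i = vpath x (zindex x (len x - i.+1)).
  by rewrite zindex_high; [congr vpath|]; lia.
by rewrite e_sym vpath_parent_adj //; lia.
Qed.

(* [p_(i-1)] and [p_i] are both adjacent to [p_(h-i)] in the zigzag tree. *)
Lemma zigzag_parent_near v : v != root -> e (f (parent v)) (f v) \/
  exists w, e (f (parent v)) w /\ e w (f v).
Proof.
move=> vr; have := fE vr.
case: zparentP => [x i xP i_range vE _|x xP vmid _ ev|_]; last by left.
- case/andP: (i_range) => i0 le_i; have hE : len x = 2 * sc x + 3 by [].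
  have mir := vpath_mirror_adj xP i_range.
  have -> : parent v = vpath x i.-1
    by rewrite vE -{1}(prednK i0) parent_vpath ?prednK.
  rewrite vE; have [i_mid|ni] := eqVneq i (sc x).+2.
    by left; move: mir; rewrite (_ : len x - i = i.-1) //; lia.
  right; exists (f (vpath x (len x - i))); split=> //; rewrite e_sym.
  have := vpath_shifted_mirror_adj xP (_ : i.-1 < len x); rewrite prednK //.
  by apply; lia.
- right; exists (f (vpath x (sc x).+2)); split=> //.
  have hE : len x = 2 * sc x + 3 by [].
  move: vmid; rewrite childrenE => /andP[_ /eqP->]; rewrite e_sym.
  have := vpath_mirror_adj xP (_ : 0 < (sc x).+1 <= len x).
  by rewrite (_ : len x - (sc x).+1 = (sc x).+2); [apply; lia | lia].
Qed.

End Adjacency.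

Lemma card_zigzag_children b u : (forall v, #|children t v| <= b) ->
  #|children zigzag_tree u| <= 2 * b + 2.
Proof.
move=> card_children.
case: (boolP [exists x in P, exists j : 'I_(len x).+1, u == vpath x j]);
  last first.
  rewrite negb_exists_in => /forall_inP none.
  have off_path x j : x \in P -> j <= len x -> vpath x j != u.
    move=> xP le_j; have := none x xP; rewrite negb_exists eq_sym.
    by move/forallP/(_ (Ordinal (le_j : j < (len x).+1))).
  apply: (@leq_trans b); last by lia.
  apply: leq_trans (card_children u); apply/subset_leq_card/subsetP => v.
  rewrite !childrenE => /andP[vr]; rewrite vr /=.
  case: zparentP => // [x i xP /andP[i0 _] _|x xP _ _].
    by rewrite (negPf (off_path x _ xP _)) // ltnW // zindex_lt.
  by rewrite (negPf (off_path x _ xP _)) // /vertical_length; lia.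
case/exists_inP => x xP /existsP[[j lt_j] /= /eqP uE].
apply: (@leq_trans #|children t u :|: children t (vpath x (sc x).+1) :|:
    [set vpath x (len x - j); vpath x (len x - j.+1)]|); last first.
  apply: leq_trans (leq_card_setU _ _) _; rewrite leq_add //; last first.
    by rewrite cards2; case: (_ != _).
  rewrite mul2n -addnn; apply: leq_trans (leq_card_setU _ _) _.
  by rewrite leq_add ?card_children.
apply/subset_leq_card/subsetP => v; rewrite childrenE => /andP[vr].
rewrite /= !in_setU !in_set1.
case: zparentP => // [x' i x'P /andP[i0 le_i] vE|x' x'P vmid vn|_] /eqP E.
- have [xx' ij] :=
    vpath_inj x'P xP (ltnW (zindex_lt x' i0)) (lt_j : j <= len x) (etrans E uE).
  rewrite vE -xx' -ij; have [le_mid|gt_mid] := leqP i (sc x').+1.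
    by rewrite zindex_low // subKn // eqxx !orbT.
  rewrite zindex_high //; have [->|ni] := eqVneq i (len x').
    by rewrite (_ : len x' - (len x').+1 = 0) ?subn0 ?eqxx ?orbT //; lia.
  by rewrite (_ : len x' - (len x' - i.+1).+1 = i) ?eqxx ?orbT //; lia.
- have le_mid : (sc x').+2 <= len x' by rewrite /vertical_length; lia.
  have [xx' _] := vpath_inj x'P xP le_mid (lt_j : j <= len x) (etrans E uE).
  by rewrite -xx' vmid orbT.
- by rewrite [v \in children t u]childrenE vr -E eqxx.
Qed.

(* The vertices that are rearranged or may hang from rearranged ones. *)
Definition inside (x v : U) : bool := below v (vpath x 1) && ~~ below v x.

Definition zcore : {set U} := [set v | [forall x in P, ~~ inside x v]].

Lemma zcoreP v : reflect {in P, forall x, ~~ inside x v} (v \in zcore).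
Proof. by rewrite inE; exact: forall_inP. Qed.

Lemma inside_segment x v : x \in P -> inside x v -> v \in seg x.
Proof.
move=> xP /andP[v1 vx]; apply: below_segment => //; apply: below_trans v1 _.
by rewrite below_vpath //= vertical_length_gt0.
Qed.

Lemma inside_vpath x i : x \in P -> 0 < i < len x -> inside x (vpath x i).
Proof.
move=> xP /andP[i0 lt_i]; rewrite /inside below_vpath ?i0 ?(ltnW lt_i) //=.
apply/negP => /leq_below_depth;
  rewrite (depth_vpath_end xP) (depth_vpath xP (ltnW lt_i)).
by lia.
Qed.

Lemma vpath0_core x : x \in P -> vpath x 0 \in zcore.
Proof.
move=> xP; apply/zcoreP => x' x'P; apply/negP => ins.
have xx' := segment_inj xP x'P (vpath_segment xP (leq0n _))
  (inside_segment x'P ins).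
case/andP: ins; rewrite -xx' => /leq_below_depth.
by rewrite (depth_vpath xP (vertical_length_gt0 _)) addn1 ltnn.
Qed.

Lemma zcore_ancestral : ancestral zigzag_tree zcore.
Proof.
split.
  apply/zcoreP => x xP; apply/negP => /andP[/leq_below_depth].
  by rewrite /= depth_root (depth_vpath xP (vertical_length_gt0 _)) addn1.
move=> v /zcoreP vZ /= vr;
  case: zparentP => // [x i xP i_range vE|x xP vmid _|none].
- have [i_end|ni] := eqVneq i (len x); last first.
    by have := vZ x xP; rewrite vE inside_vpath //; lia.
  rewrite i_end (_ : zindex x (len x) = 0); first exact: vpath0_core.
  by rewrite zindex_high /vertical_length; lia.
- case/negP: (vZ x xP); have mid : 0 < (sc x).+1 < len x.
    by rewrite /vertical_length; lia.
  move: (vmid); rewrite childrenE => /andP[_ /eqP pv].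
  case/andP: (inside_vpath xP mid) => mid1 _; apply/andP; split.
    by apply: below_trans (below_parent vr) _; rewrite pv.
  apply/negP => /leq_below_depth;
    rewrite (depth_vpath_end xP) (depth_mid_child xP vmid).
  by rewrite /vertical_length; lia.
- apply/zcoreP => x xP; apply/negP => /andP[p1 px]; case/negP: (vZ x xP).
  apply/andP; split; first exact: below_trans (below_parent vr) p1.
  apply/negP => vx; have [E|vnx] := eqVneq v x.
    by have := none x xP;
      rewrite E -{2}(vpath_end x) rewired_vpath // vertical_length_gt0 leqnn.
  by rewrite below_parentl in px.
Qed.

Lemma zigzag_top x : x \in P -> zigzag x 0 \in zcore.
Proof. exact: vpath0_core. Qed.

Lemma zigzag_notin_core x : x \in P -> forall j, j <= (sc x).*2.+1 ->
  zigzag x j.+1 \notin zcore.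
Proof.
move=> xP j /zpos_range zr; apply/negP => /zcoreP/(_ x xP).
by rewrite inside_vpath.
Qed.

Lemma zigzag_top_inj : {in P &, injective (zigzag^~ 0)}.
Proof. by move=> x x' xP x'P /(vpath_inj xP x'P (leq0n _) (leq0n _))[]. Qed.

Lemma zigzag_inj : {in P &, forall x x' i j,
  i <= (sc x).*2.+1 -> j <= (sc x').*2.+1 ->
  zigzag x i.+1 = zigzag x' j.+1 -> x = x' /\ i = j}.
Proof.
move=> x x' xP x'P i j le_i le_j.
have /andP[_ /ltnW lt_i] := zpos_range le_i.
have /andP[_ /ltnW lt_j] := zpos_range le_j.
case/(vpath_inj xP x'P lt_i lt_j) => xx' E; split=> //; rewrite -xx' in le_j E.
by apply: succn_inj; exact: zpos_inj E.
Qed.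

Lemma zigzag_leaf x : x \in P -> forall u, u != root ->
  zparent u != zigzag x (sc x).*2.+2.
Proof.
move=> xP u ur; have -> : zigzag x (sc x).*2.+2 = vpath x (sc x).+1.
  by rewrite /zigzag /zpos /= odd_double /= doubleK.
have le_mid : (sc x).+1 <= len x by rewrite /vertical_length; lia.
apply/eqP.
case: zparentP => // [x' i x'P /andP[i0 le_i] uE|x' x'P umid un|none] E.
- have [xx' zi] := vpath_inj x'P xP (ltnW (zindex_lt x' i0)) le_mid E.
  by have := zindex_neq_mid le_i; rewrite zi xx' eqxx.
- have [|xx'] := vpath_inj x'P xP _ le_mid E.
    by rewrite /vertical_length; lia.
  by rewrite xx'; lia.
- by have := none x xP; rewrite /rewired childrenE ur E eqxx orbT.
Qed.

Definition zigzag_pendant_paths : pendant_paths zigzag_tree :=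
  @PendantPaths U zigzag_tree zcore P sc zigzag zcore_ancestral zigzag_top
    zigzag_notin_core zigzag_top_inj zigzag_inj
    (fun x xP j => @zparent_zigzag x j xP) zigzag_leaf.

End Zigzag.

(** * Trees as graphs *)

Lemma has_walkP (G : sgraph) k (x z : G) :
  reflect (exists p, [/\ size p = k, path (@adj G) x p & last x p = z])
          (has_walk k x z).
Proof.
apply: (iffP existsP) => [[p /andP[pp /eqP pl]]|[p [sp pp pl]]].
  by exists p; rewrite size_tuple.
have sp' : size p == k by apply/eqP.
by exists (Tuple sp'); rewrite /= pp pl eqxx.
Qed.

Lemma square_adjP (G : sgraph) (x z : G) : x != z ->
  adj x z \/ (exists w, adj x w /\ adj w z) -> square_adj x z.
Proof.
move=> xz [xz'|[w [xw wz]]]; rewrite /square_adj ?xz' //.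
case: (boolP (adj x z)) => //= nxz; apply/andP; split.
  by apply/has_walkP; exists [:: w; z]; rewrite /= xw wz.
apply/forallP => -[[|[|j]] //= _]; apply/negP => /has_walkP[p [sp pp pl]].
  by case: p sp pp pl => //= _ _ E; rewrite E eqxx in xz.
case: p sp pp pl => [|a [|]] //= _; rewrite andbT => xa E.
by rewrite E (negPf nxz) in xa.
Qed.

Section TreeRoot.

Variables (T : sgraph) (rt : T).
Hypothesis conn : forall u : T, connect (@adj T) rt u.

Lemma walk_exists u : exists k, has_walk k rt u.
Proof.
by have /connectP[p pp ->] := conn u; exists (size p);
  apply/has_walkP; exists p.
Qed.

Definition root_dist (u : T) : nat := ex_minn (walk_exists u).

Lemma root_dist_walk u : has_walk (root_dist u) rt u.
Proof. by rewrite /root_dist; case: ex_minnP. Qed.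

Lemma root_dist_min k u : has_walk k rt u -> root_dist u <= k.
Proof. by rewrite /root_dist; case: ex_minnP => m _; apply. Qed.

Lemma root_dist_adj u v : adj u v -> root_dist v <= (root_dist u).+1.
Proof.
move=> uv; have /has_walkP[p [sp pp pl]] := root_dist_walk u.
apply/root_dist_min/has_walkP; exists (rcons p v).
by rewrite size_rcons sp rcons_path pp pl uv last_rcons.
Qed.

Definition closer_neighbour (u : T) : T :=
  odflt rt [pick v | adj v u && ((root_dist v).+1 == root_dist u)].

Lemma closer_neighbourP u : u != rt ->
  adj (closer_neighbour u) u /\
    root_dist u = (root_dist (closer_neighbour u)).+1.
Proof.
move=> ur; rewrite /closer_neighbour; case: pickP => [v /andP[vu /eqP]//|none].
have /has_walkP[p [sp pp pl]] := root_dist_walk u.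
case/lastP: p => [|p v] in sp pp pl; first by rewrite -pl eqxx in ur.
rewrite last_rcons in pl; rewrite rcons_path pl in pp; case/andP: pp => pp pv.
have le_p : root_dist (last rt p) <= size p.
  by apply/root_dist_min/has_walkP; exists p.
have le_u := root_dist_adj pv; rewrite size_rcons in sp.
by have := none (last rt p); rewrite pv /= => /eqP[]; lia.
Qed.

Lemma closer_neighbour_rootward u : exists k, iter k closer_neighbour u == rt.
Proof.
have [n] := ubnP (root_dist u); elim: n => // n IHn in u *;
  rewrite ltnS => le_n.
have [->|ur] := eqVneq u rt; first by exists 0.
have [|k pk] := IHn (closer_neighbour u); last by exists k.+1; rewrite iterSr.
by have [_ <-] := closer_neighbourP ur.
Qed.

Definition distance_tree : rooted_tree T :=
  RootedTree closer_neighbour_rootward.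

(* An edge that does not lead to a parent would close a cycle with the walks
   through the parents. *)
Lemma acyclic_adj_parent u v : acyclic T -> adj u v ->
  v \in children distance_tree u \/ u \in children distance_tree v.
Proof.
move=> acyc uv; rewrite !childrenE /=; set par := closer_neighbour.
case: (boolP ((v != rt) && (par v == u))) => [|nv]; first by left.
case: (boolP ((u != rt) && (par u == v))) => [|nu]; first by right.
have unv : u != v by apply: contraTneq uv => ->; rewrite adj_irr.
pose e' : rel T := fun x y => adj x y &&
  ~~ [|| (x == u) && (y == v) | (x == v) && (y == u)].
have e'_sym : symmetric e'.
  by move=> x y; rewrite /e' adj_sym; congr (_ && ~~ _);
    rewrite orbC ![(_ == u) && _]andbC.
have con w : connect e' rt w.
  have [k] := ubnP (root_dist w); elim: k => // k IHk in w *;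
    rewrite ltnS => wk.
  have [->|wr] := eqVneq w rt; first exact: connect0.
  have [pw dw] := closer_neighbourP wr.
  apply: connect_trans (IHk (par w) _) (connect1 _); first by rewrite -dw.
  rewrite /e' pw /= negb_or !negb_and; apply/andP; split.
    have [wv|] := eqVneq w v; last by rewrite orbT.
    by move: nv; rewrite -wv wr /= => ->.
  have [wu|] := eqVneq w u; last by rewrite orbT.
  by move: nu; rewrite -wu wr /= => ->.
have /connectP[p0 pp0 pl0] : connect e' u v.
  by apply: connect_trans (con v); rewrite (sym_connect_sym e'_sym); exact: con.
case/shortenP: pp0 pl0 => p pp up _ pl.
have sz : 1 < size p.
  case: p => [|x [|z p]] //= in pp up pl *.
    by rewrite pl eqxx in unv.
  by move: pp; rewrite /e' -pl !eqxx /= andbF.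
exfalso; apply: (acyc (u :: p)) => //; apply/andP; split=> //.
rewrite /= rcons_path -pl adj_sym uv andbT.
by apply: sub_path pp => x z /andP[].
Qed.

End TreeRoot.

Lemma tree_rooting (T : sgraph) : is_tree T ->
  exists t : rooted_tree T,
    (forall u v, v \in children t u -> adj u v) /\
    (forall u v, adj u v -> v \in children t u \/ u \in children t v).
Proof.
case=> -[/card_gt0P[rt _] conn] acyc; exists (distance_tree (conn rt)); split.
  by move=> u v; rewrite childrenE
    => /andP[/(closer_neighbourP (conn rt))[adjv _] /eqP <-].
by move=> u v; exact: acyclic_adj_parent.
Qed.

(** * Expanding graphs *)

Definition expanding (V : finType) (e : rel V) (r : nat) : Prop :=
  forall X : {set V}, r ^ 2 * #|V| * #|X| <= #|nb e X| * (#|V| + r ^ 2 * #|X|).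

Lemma leq_ceil_mul r n : r <= n -> (n %/ r).+1 * r <= 2 * n.
Proof. by move=> le_r; rewrite mulSn mul2n -addnn leq_add // leq_divM. Qed.

Section Expansion.

Variables (V : finType) (e : rel V) (D r : nat).

Let n := #|V|.
Let m := (n %/ r).+1.

Hypothesis r_gt0 : 0 < r.
Hypothesis r_le : r <= n.
Hypothesis expand : expanding e r.

Lemma expanding_joined : joined e m.
Proof.
move=> X mX; rewrite ltnNge; apply/negP => le_N.
have lt_n : n < m * r := ltn_ceil n r_gt0.
have := expand X; rewrite -/n.
move: (#|nb e X|) (#|X|) mX le_N lt_n; rewrite -/n;
  move: (n) (m) => k l N x le_lx le_N lt_k.
rewrite (expnS r 1) expn1 => le_exp.
have : N * (k + r * r * x) + l * (k + r * r * x) <= k * (k + r * r * x).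
  by rewrite -mulnDl leq_mul2r le_N orbT.
have : l * r * (l * r) <= l * (r * r * x).
  by rewrite mulnACA -mulnA leq_mul2l [r * r * x]mulnC leq_mul2r le_lx !orbT.
have : k * k < l * r * (l * r) by apply: ltn_mul.
by lia.
Qed.

Lemma expanding_extendable : 5 * D <= r -> extendable e D m set0 (fun=> 0).
Proof.
move=> rD X mX; rewrite setD0; under eq_bigr do rewrite subn0.
rewrite sum_nat_const leqNgt; apply/negP => lt_N.
have n_gt0 : 0 < n := leq_trans r_gt0 r_le.
have := expand X; rewrite -/n; move: (leq_ceil_mul r_le) n_gt0; rewrite -/m.
move: (#|nb e X|) (#|X|) mX lt_N;
  move: (n) (m) => k l N x le_xl lt_N le_lr k_gt0.
rewrite (expnS r 1) expn1 => le_exp.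
have le_x : r * r * x <= 4 * r * k.
  have : r * r * x <= r * r * l.*2 by rewrite leq_mul2l le_xl orbT.
  have : r * (l * r) <= r * (2 * k) by rewrite leq_mul2l le_lr orbT.
  by rewrite -mul2n; lia.
have : N * (k + r * r * x) <= N * (5 * r * k).
  rewrite leq_mul2l; apply/orP; right.
  have : k <= r * k by rewrite leq_pmull.
  by lia.
have : 5 * D * x <= r * x by rewrite leq_mul2r rD orbT.
have := leq_pmul2l (_ : 0 < r * k);
  rewrite muln_gt0 r_gt0 k_gt0 => /(_ (r * x) (5 * N) isT).
by lia.
Qed.

End Expansion.

Section Constants.

Variable b : nat.

Definition growth : nat := (b ^ 19) ^ 3.
Definition demand : nat := 2 * b + 2 + 4 + growth.
Definition supply : nat := 2 * demand + 11.
Definition ratio : nat := 8 * supply * (growth * growth).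

Lemma supply_gt0 : 0 < supply.
Proof. by rewrite addn_gt0 orbT. Qed.

Lemma demand_gt1 : 1 < demand.
Proof. by rewrite /demand; lia. Qed.

Hypothesis b_gt1 : 1 < b.

Lemma growth_gt1 : 1 < growth.
Proof. by rewrite /growth -expnM -(exp1n (19 * 3)) ltn_exp2r. Qed.

Lemma leq_demand_ratio : 5 * demand <= ratio.
Proof.
by have := growth_gt1; rewrite /ratio /supply; move: growth demand => g D; nia.
Qed.

Lemma ratio_gt1 : 1 < ratio.
Proof. by have := leq_demand_ratio; have := demand_gt1; lia. Qed.

Section Scales.

Variable n : nat.
Hypothesis n_large : ratio <= n.

Let m := (n %/ ratio).+1.
Let S := (trunc_log growth m).+1.

Lemma leq_threshold_scale : m <= growth ^ S.
Proof. by apply: ltnW; apply: trunc_log_ltn growth_gt1. Qed.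

Lemma supply_fits : 2 * supply * growth ^ S.+1 < n.
Proof.
have g_gt0 := ltnW growth_gt1.
have le_S : growth ^ S <= growth * m.
  by rewrite /S expnS leq_mul2l trunc_logP ?growth_gt1 ?orbT.
have := leq_ceil_mul n_large; rewrite -/m.
have : 2 * supply * (growth * growth ^ S) <=
  2 * supply * (growth * (growth * m)).
  by rewrite !leq_mul2l le_S !orbT.
have : 0 < supply * (growth * (growth * m)).
  by rewrite muln_gt0 supply_gt0 muln_gt0 g_gt0 muln_gt0 g_gt0.
by rewrite expnS /ratio; move: (growth ^ S) m supply growth => q m' k g; lia.
Qed.

Lemma threshold_room : (4 * m).+1 + m + m.*2 * demand <= n.
Proof.
apply: leq_trans (ltnW supply_fits).
have : m <= growth ^ S.+1.
  by apply: leq_trans leq_threshold_scale _; rewrite leq_exp2l ?growth_gt1.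
by rewrite /supply; move: (growth ^ S.+1) demand (ltn0Sn (n %/ ratio));
  rewrite -/m => q D; nia.
Qed.

Lemma supply_sufficient k : supply * growth ^ S <= k ->
  6 * m + 4 * growth ^ S + m.*2 * demand < k.
Proof.
apply: leq_trans; have := leq_threshold_scale; rewrite /supply.
by move: (growth ^ S) demand (ltn0Sn (n %/ ratio)); rewrite -/m => q D; nia.
Qed.

End Scales.

End Constants.

Section ExpandingSpanning.

Variables (b : nat) (U V : finType) (e : rel V).
Hypothesis b_gt1 : 1 < b.
Hypothesis e_sym : symmetric e.
Hypothesis card_UV : #|U| = #|V|.
Hypothesis V_large : ratio b <= #|V|.
Hypothesis expand : expanding e (ratio b).

Let g := growth b.
Let m := (#|V| %/ ratio b).+1.
Let S := (trunc_log g m).+1.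

Let ratio_gt0 : 0 < ratio b := ltnW (ratio_gt1 b_gt1).

Lemma expanding_spanning_tree (t : rooted_tree U) (P : pendant_paths t) :
  (forall u, #|children t u| <= 2 * b + 2) ->
  (forall k, 0 < k <= S ->
    #|[set x in places P | scale P x == k]| = supply b * g ^ (S.+1 - k)) ->
  exists F : U -> V, embedding t e setT F.
Proof.
move=> card_children card_places.
have join : joined e m by apply: expanding_joined.
have ext0 : extendable e (demand b) m set0 (fun=> 0).
  by apply: expanding_extendable; rewrite ?leq_demand_ratio.
have room0 : room V (demand b) m (4 * m).+1 by apply: threshold_room.
have [A [cA [extA cA2 card_A domA]]] :=
  dominating_set (ltn0Sn _) join (demand_gt1 b) ext0 room0.
apply: (spanning_embedding (P := P) (S := S) (g := g) e_sym (ltn0Sn _) join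
  card_children _ _ card_UV (ltn0Sn _) _ _ _ card_A extA cA2 domA).
- exact: growth_gt1.
- exact: leqnn.
- exact: leq_threshold_scale.
- by move=> k k_range; rewrite card_places // leq_mul2r /supply; lia.
- apply: supply_sufficient => //; have := card_places 1 isT;
    rewrite subn1 => <-.
  by apply/subset_leq_card/subsetP => x; rewrite inE => /andP[].
Qed.

Lemma expanding_near_embedding (t : rooted_tree U) :
  (forall u, #|children t u| <= b) ->
  exists2 F : U -> V, injective F & forall u, u != tree_root t ->
    e (F (parent t u)) (F u) \/ exists w, e (F (parent t u)) w /\ e w (F u).
Proof.
move=> card_children.
have [P [sc [fam card_P]]] : exists P sc, vertical_family t P sc /\
    forall s, 0 < s <= S -> #|[set x in P | sc x == s]| =
      supply b * g ^ (S.+1 - s).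
  apply: (vertical_family_exists card_children) => //; first exact: supply_gt0.
  by rewrite card_UV; exact: supply_fits.
have [F [_ injF adjF]] := @expanding_spanning_tree _ (zigzag_pendant_paths fam)
  (fun u => card_zigzag_children fam u card_children) card_P.
exists F => [x y|]; first exact: injF.
by apply: (zigzag_parent_near fam e_sym) => u; exact: adjF.
Qed.

End ExpandingSpanning.

Lemma square_contains_tree (b : nat) (G T : sgraph) :
  1 < b -> is_tree T -> #|T| = #|G| -> max_degree T <= b -> ratio b <= #|G| ->
  expanding (@adj G) (ratio b) -> contains_copy (square G) T.
Proof.
move=> b_gt1 treeT card_TG degT G_large expand.
have [t [adj_children children_adj]] := tree_rooting treeT.
have card_children u : #|children t u| <= b.
  apply: leq_trans (leq_trans (leq_bigmax u) degT).
  by apply/subset_leq_card/subsetP => v /adj_children; rewrite inE.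
have [F injF nearF] := expanding_near_embedding b_gt1 (@adj_sym G) card_TG
  G_large expand card_children.
have near u v : v \in children t u -> square_adj (F u) (F v).
  rewrite childrenE => /andP[vr /eqP <-]; apply: square_adjP; last exact: nearF.
  by apply/eqP => /injF pv; have := depth_parent vr; rewrite pv => /n_Sn.
exists F => // x y /children_adj[]/near//.
by rewrite /= square_adj_sym.
Qed.

(** * Expansion from the spectrum *)

Import Order.TTheory GRing.Theory Num.Theory.
Local Open Scope ring_scope.

Section SpectralBound.

Local Open Scope sesquilinear_scope.

Lemma char_poly_conj (F : fieldType) n (P M : 'M[F]_n) : P \in unitmx ->
  char_poly (invmx P *m M *m P) = char_poly M.
Proof.
move=> Pu; rewrite /char_poly /char_poly_mx.
have VP : map_mx polyC (invmx P) *m map_mx polyC P = 1%:M.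
  by rewrite -map_mxM mulVmx // map_mx1.
have -> : 'X%:M - map_mx polyC (invmx P *m M *m P) =
    map_mx polyC (invmx P) *m ('X%:M - map_mx polyC M) *m map_mx polyC P.
  rewrite mulmxBr mulmxBl !map_mxM; congr (_ - _).
  by rewrite -mulmxA -scalar_mxC mulmxA VP mul1mx.
by rewrite !det_mulmx mulrAC -det_mulmx VP det1 mul1r.
Qed.

Variables (C : numClosedFieldType) (n : nat) (A : 'M[C]_n).
Hypothesis normalA : A \is normalmx.

Local Notation D := (spectral_diag A).

Lemma char_poly_spectral_diag : char_poly A = \prod_i ('X - (D 0 i)%:P).
Proof.
rewrite [in LHS](orthomx_spectralP normalA) char_poly_conj ?spectral_unit //.
rewrite char_poly_trig ?diag_mx_is_trig //.
by apply: eq_bigr => i _; rewrite mxE eqxx.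
Qed.

Lemma sum_sqr_norm_unitary (P : 'M[C]_n) (v : 'rV[C]_n) : P \is unitarymx ->
  \sum_j `|(v *m P) 0 j| ^+ 2 = \sum_j `|v 0 j| ^+ 2.
Proof.
have sum_sqr_norm (z : 'rV[C]_n) : \sum_j `|z 0 j| ^+ 2 = (z *m z^t*) 0 0.
  by rewrite mxE; apply: eq_bigr => j _; rewrite normCK !mxE.
move=> /unitarymxP PPt.
by rewrite !sum_sqr_norm trmx_mul map_mxM mulmxA -(mulmxA v) PPt mulmx1.
Qed.

Variables (s : seq C) (lambda : C).
Hypothesis char_polyA : char_poly A = \prod_(a <- s) ('X - a%:P).
Hypothesis small : forall a, a \in behead s -> `|a| <= lambda.

Lemma large_eigenvalue_uniq i j :
  ~~ (`|D 0 i| <= lambda) -> ~~ (`|D 0 j| <= lambda) -> i = j.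
Proof.
pose large (a : C) := ~~ (`|a| <= lambda).
have perm_s : perm_eq s [seq D 0 k | k : 'I_n].
  by apply: prod_XsubC_eq;
    rewrite -char_polyA char_poly_spectral_diag big_image.
have count_s : (count large s <= 1)%N.
  case: s small => //= a s' small_s';
    rewrite (eq_in_count (a2 := pred0)) ?count_pred0.
    by rewrite addn0 leq_b1.
  by move=> x /small_s' x_small; rewrite /large x_small.
pose L := [pred k | large (D 0 k)].
have card_L : #|L| = count large s.
  by rewrite -sum1_count (perm_big _ perm_s) /= big_image_cond sum1_card.
move=> Di Dj; have /card_le1_eqP : (#|L| <= 1)%N by rewrite card_L.
by apply; rewrite inE.
Qed.

Local Notation P := (spectralmx A).

Let P_unitary : P \is unitarymx := spectral_unitarymx A.

Let mulVP : P^t* *m P = 1%:M.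
Proof. by rewrite -invmx_unitary // mulVmx // unitarymx_unit. Qed.

Let mulPV : P *m P^t* = 1%:M.
Proof. exact/unitarymxP. Qed.

Let spectral_decomposition : A = P^t* *m diag_mx D *m P.
Proof. by rewrite -invmx_unitary //; exact/orthomx_spectralP. Qed.

Lemma eigenvector_coord (d : C) (u : 'rV[C]_n) i : u *m A = d *: u ->
  (u *m P^t* ) 0 i * D 0 i = d * (u *m P^t* ) 0 i.
Proof.
move=> uA; have : u *m P^t* *m diag_mx D = d *: (u *m P^t* ).
  rewrite scalemxAl -uA {3}spectral_decomposition !mulmxA.
  by rewrite -(mulmxA _ P) mulPV mulmx1.
by move=> /matrixP/(_ 0 i); rewrite mul_mx_diag mxE [RHS]mxE.
Qed.

(* In the eigenbasis [u] is supported on the coordinate of the eigenvalue [d],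
   so that this coordinate of [w] vanishes. *)
Lemma spectral_bound (d : C) (u w : 'rV[C]_n) :
  ~~ (`|d| <= lambda) -> u != 0 -> u *m A = d *: u -> w *m u^t* = 0 ->
  \sum_j `|(w *m A) 0 j| ^+ 2 <= lambda ^+ 2 * \sum_j `|w 0 j| ^+ 2.
Proof.
move=> d_large u0 uA wu; pose z := w *m P^t*; pose y := u *m P^t*.
have yD i : y 0 i * D 0 i = d * y 0 i := eigenvector_coord i uA.
have [i0 yi0] : exists i, y 0 i != 0.
  apply/existsP; apply: contraNT u0; rewrite negb_exists => /forallP y0.
  have -> : u = y *m P by rewrite -mulmxA mulVP mulmx1.
  suff -> : y = 0 by rewrite mul0mx.
  by apply/rowP => i; rewrite [RHS]mxE; apply/eqP; have := y0 i; rewrite negbK.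
have D_large i : y 0 i != 0 -> ~~ (`|D 0 i| <= lambda).
  by move=> yi; rewrite (_ : D 0 i = d) //; apply: (mulfI yi); rewrite yD mulrC.
have y0 i : i != i0 -> y 0 i = 0.
  move=> ii0; apply/eqP; apply: contraNT ii0 => yi.
  by apply/eqP/large_eigenvalue_uniq; exact: D_large.
have y_conj i : (y^t* ) i 0 = (y 0 i)^* by rewrite [LHS]mxE [y^T _ _]mxE.
have zi0 : z 0 i0 = 0.
  have : z *m y^t* = 0.
    rewrite /z /y trmx_mul map_mxM map_trmx trmxK -map_mx_comp.
    by rewrite (map_mx_id (@conjCK _)) mulmxA -(mulmxA w) mulVP mulmx1.
  move=> /matrixP/(_ 0 0).
  rewrite [LHS]mxE [RHS]mxE (bigD1 i0) //= big1 => [|i ii0].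
    rewrite y_conj addr0 => /eqP; rewrite mulf_eq0 conjC_eq0 (negPf yi0) orbF.
    by move/eqP.
  by rewrite y_conj y0 // conjC0 mulr0.
have -> : w *m A = z *m diag_mx D *m P.
  by rewrite {1}spectral_decomposition !mulmxA.
have -> : \sum_j `|w 0 j| ^+ 2 = \sum_j `|z 0 j| ^+ 2.
  by rewrite -(sum_sqr_norm_unitary z P_unitary) -mulmxA mulVP mulmx1.
rewrite sum_sqr_norm_unitary // mulr_sumr; apply: ler_sum => i _.
rewrite mul_mx_diag mxE; have [->|ii0] := eqVneq i i0.
  by rewrite zi0 mul0r normr0 expr0n mulr0.
have Di : `|D 0 i| <= lambda.
  apply: contraNT ii0 => Di.
  exact/eqP/(large_eigenvalue_uniq Di (D_large i0 yi0)).
rewrite normrM exprMn mulrC ler_wpM2r ?exprn_ge0 //.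
by rewrite lerXn2r ?nnegrE // (le_trans (normr_ge0 _) Di).
Qed.

End SpectralBound.

Lemma real_spectral_bound (R : rcfType) n (A : 'M[R]_n) (d lambda : R)
    (s : seq R) (u w : 'rV[R]_n) :
  A^T = A -> char_poly A = \prod_(a <- s) ('X - a%:P) ->
  (forall a, a \in behead s -> `|a| <= lambda) -> lambda < `|d| ->
  u != 0 -> u *m A = d *: u -> w *m u^T = 0 ->
  \sum_j (w *m A) 0 j ^+ 2 <= lambda ^+ 2 * \sum_j w 0 j ^+ 2.
Proof.
move=> symA char_polyA small d_large u0 uA wu.
pose f : {rmorphism R -> R[i]} := real_complex R.
have f_le x y : (f x <= f y) = (x <= y) := lecR x y.
have f_conj x : (f x)^* = f x := conjc_real x.
have f_norm x : `|f x| = f `|x|.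
  have pos (x' : R) : 0 <= x' -> `|f x'| = f x'.
    by move=> x'0; apply: ger0_norm; rewrite -(rmorph0 f) f_le.
  have [x0|/ltW x0] := leP 0 x; first by rewrite pos // ger0_norm.
  by rewrite (ler0_norm x0) -[LHS]normrN -rmorphN pos ?oppr_ge0.
have f_sqr x : `|f x| ^+ 2 = f (x ^+ 2).
  by rewrite f_norm -rmorphXn /= real_normK ?num_real.
have f_adjoint m p (M : 'M[R]_(m, p)) : ((map_mx f M)^t* )%sesqui =
  map_mx f M^T.
  by apply/matrixP => i j; rewrite !mxE f_conj.
have sumE (v : 'rV[R]_n) : \sum_j `|map_mx f v 0 j| ^+ 2 =
  f (\sum_j v 0 j ^+ 2).
  by rewrite rmorph_sum; apply: eq_bigr => j _; rewrite mxE f_sqr.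
rewrite -f_le rmorphM rmorphXn -!sumE map_mxM.
apply: (@spectral_bound _ _ _ _ (map f s) _ _ _ (f d) (map_mx f u)).
- by apply/normalmxP; rewrite f_adjoint symA.
- by rewrite -map_char_poly char_polyA map_prod_XsubC big_map.
- move=> a; rewrite behead_map => /mapP[a' a's ->].
  by rewrite f_norm f_le small.
- by rewrite f_norm f_le -ltNge.
- by rewrite map_mx_eq0.
- by rewrite -map_mxM uA map_mxZ.
- by rewrite f_adjoint -map_mxM wu map_mx0.
Qed.

Lemma sqr_sum_leq (R : realFieldType) (I : finType) (S : {set I}) (c : I -> R) :
  (\sum_(i in S) c i) ^+ 2 <= #|S|%:R * \sum_(i in S) c i ^+ 2.
Proof.
set T := \sum_(i in S) c i; set Q := \sum_(i in S) c i ^+ 2.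
have [S0|S_gt0] := posnP #|S|.
  by rewrite /T (cards0_eq S0) big_set0 expr0n cards0 mul0r.
have : 0 <= \sum_(i in S) (#|S|%:R * c i - T) ^+ 2.
  by apply: sumr_ge0 => i _; exact: sqr_ge0.
have -> : \sum_(i in S) (#|S|%:R * c i - T) ^+ 2 =
  #|S|%:R * (#|S|%:R * Q - T ^+ 2).
  rewrite (eq_bigr (fun i =>
    #|S|%:R ^+ 2 * c i ^+ 2 - 2 * #|S|%:R * T * c i + T ^+ 2)).
    by rewrite big_split sumrB -!mulr_sumr /= sumr_const -mulr_natl -/Q -/T;
      ring.
  by move=> i _; ring.
by rewrite pmulr_rge0 ?ltr0n // subr_ge0.
Qed.

Lemma sum_sqr_deviation (F : fieldType) (I : finType) (c : I -> F) :
  #|I|%:R != 0 :> F ->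
  \sum_i (c i - (\sum_j c j) / #|I|%:R) ^+ 2 =
    \sum_i c i ^+ 2 - (\sum_j c j) ^+ 2 / #|I|%:R.
Proof.
move=> N0; set T := \sum_j c j; set N := #|I|%:R in N0 *.
rewrite (eq_bigr (fun i => c i ^+ 2 - 2 * (T / N) * c i + (T / N) ^+ 2)).
  by rewrite big_split sumrB -mulr_sumr /= sumr_const -mulr_natr -/T -/N; field.
by move=> i _; ring.
Qed.

Lemma sum_enum_val (R : nmodType) (T : finType) (F : T -> R) :
  \sum_(j < #|T|) F (enum_val j) = \sum_x F x.
Proof. by rewrite -(big_enum_val F). Qed.

Lemma sum_indicator (R : nzSemiRingType) (T : finType) (X : {set T}) :
  \sum_x (x \in X)%:R = #|X|%:R :> R.
Proof. by rewrite -natr_sum sum_mem. Qed.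

Section NeighbourhoodBound.

Variables (R : realType) (G : sgraph) (n d : nat) (lambda : R).
Hypothesis ndlG : ndl_graph n d lambda G.
Hypothesis lambda_lt : lambda < d%:R.
Hypothesis n_gt0 : (0 < n)%N.
Variable X : {set G}.

Let k : R := #|X|%:R.
Let N : R := n%:R.

Definition degree_in (x : G) : R := \sum_(y in X) (adj y x)%:R.

Lemma sum_adj (x : G) : \sum_y (adj x y)%:R = d%:R :> R.
Proof.
case: ndlG => _ /(_ x) <- _; rewrite -sum_indicator.
by apply: eq_bigr => y _; rewrite inE.
Qed.

Lemma sum_degree_in : \sum_x degree_in x = d%:R * k.
Proof.
rewrite exchange_big /= (eq_bigr (fun=> d%:R)) => [|y _]; last exact: sum_adj.
by rewrite sumr_const mulr_natr.
Qed.

Lemma degree_in_mul_adj_mx j :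
  ((\row_i (enum_val i \in X)%:R) *m adj_mx R G) 0 j = degree_in (enum_val j).
Proof.
rewrite mxE /degree_in [RHS]big_mkcond -[RHS]sum_enum_val /=;
  apply: eq_bigr => i _.
by rewrite !mxE; case: (_ \in X); rewrite ?mul1r ?mul0r.
Qed.

Lemma ones_mul_adj_mx :
  const_mx 1 *m adj_mx R G = d%:R *: const_mx 1 :> 'rV[R]_#|G|.
Proof.
apply/rowP => j; rewrite !mxE mulr1 -(sum_adj (enum_val j)) -[RHS]sum_enum_val.
by apply: eq_bigr => i _; rewrite !mxE mul1r adj_sym.
Qed.

Lemma degree_in_deviation :
  \sum_x (degree_in x - d%:R * k / N) ^+ 2 <=
    lambda ^+ 2 * \sum_x ((x \in X)%:R - k / N) ^+ 2.
Proof.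
have [cardG _ [s [_ char_polyA] small]] := ndlG.
have N0 : N != 0 by rewrite pnatr_eq0 -lt0n.
pose w : 'rV[R]_#|G| := (\row_i (enum_val i \in X)%:R) - (k / N) *: const_mx 1.
have wA j : (w *m adj_mx R G) 0 j = degree_in (enum_val j) - d%:R * k / N.
  rewrite mulmxBl -scalemxAl ones_mul_adj_mx mxE degree_in_mul_adj_mx
    !mxE mulr1.
  by rewrite mulrC mulrA.
have -> : \sum_x (degree_in x - d%:R * k / N) ^+ 2 =
  \sum_j (w *m adj_mx R G) 0 j ^+ 2.
  by rewrite -sum_enum_val; apply: eq_bigr => j _; rewrite wA.
have -> : \sum_x ((x \in X)%:R - k / N) ^+ 2 = \sum_j w 0 j ^+ 2.
  by rewrite -sum_enum_val; apply: eq_bigr => j _; rewrite !mxE mulr1.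
apply: real_spectral_bound char_polyA small _ _ ones_mul_adj_mx _.
- by apply/matrixP => i j; rewrite !mxE adj_sym.
- by rewrite ger0_norm.
- have G_gt0 : (0 < #|G|)%N by rewrite cardG.
  apply/eqP => /rowP/(_ (Ordinal G_gt0)); rewrite !mxE => /eqP.
  by rewrite oner_eq0.
apply/matrixP => i j; rewrite !mxE.
under eq_bigr do rewrite !mxE !mulr1.
rewrite (sum_enum_val (fun x => (x \in X)%:R - k / N)) sumrB sum_indicator
  sumr_const.
by rewrite -/k cardG -mulr_natr -/N mulfVK // subrr.
Qed.

Lemma sum_sqr_degree_in :
  (\sum_x degree_in x ^+ 2) * N <= d%:R ^+ 2 * k ^+ 2 + lambda ^+ 2 * N * k.
Proof.
have [cardG _ _] := ndlG; have cardN : #|G|%:R = N by rewrite cardG.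
have N_gt0 : 0 < N by rewrite ltr0n.
have N0 : N != 0 by rewrite gt_eqF.
set Q := \sum_x degree_in x ^+ 2.
have devE : \sum_x (degree_in x - d%:R * k / N) ^+ 2 = Q - (d%:R * k) ^+ 2 / N.
  by rewrite -sum_degree_in -cardN sum_sqr_deviation ?cardN.
have indE : \sum_x ((x \in X)%:R - k / N) ^+ 2 = k - k ^+ 2 / N.
  have := @sum_sqr_deviation R G (fun x => (x \in X)%:R).
  rewrite cardN sum_indicator => /(_ N0) ->; congr (_ - _).
  rewrite /k -(sum_indicator R X); apply: eq_bigr => x _.
  by case: (x \in X); rewrite ?expr0n ?expr1n.
have := degree_in_deviation; rewrite devE indE -(ler_pM2r N_gt0).
have -> : (Q - (d%:R * k) ^+ 2 / N) * N = Q * N - (d%:R * k) ^+ 2 by field.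
have -> : lambda ^+ 2 * (k - k ^+ 2 / N) * N =
    lambda ^+ 2 * N * k - (lambda * k) ^+ 2 by field.
by have := sqr_ge0 (lambda * k); lra.
Qed.

Lemma nb_lower_bound :
  d%:R ^+ 2 * k ^+ 2 * N <=
    #|nb (@adj G) X|%:R * (d%:R ^+ 2 * k ^+ 2 + lambda ^+ 2 * N * k).
Proof.
have degree_in0 x : x \notin nb (@adj G) X -> degree_in x = 0.
  move=> xX; rewrite /degree_in big1 // => y yX;
    case: (boolP (adj y x)) => // yx.
  by case/negP: xX; apply/nbP; exists y.
have sum_nb (F : R -> R) : F 0 = 0 ->
    \sum_(x in nb (@adj G) X) F (degree_in x) = \sum_x F (degree_in x).
  move=> F0; rewrite [LHS]big_mkcond; apply: eq_bigr => x _.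
  by case: ifPn => // /degree_in0->.
have := sqr_sum_leq (nb (@adj G) X) degree_in.
rewrite (sum_nb id) // (sum_nb (fun z => z ^+ 2)) ?expr0n //
  sum_degree_in => CS.
apply: le_trans (ler_wpM2l (ler0n R #|nb (@adj G) X|) sum_sqr_degree_in).
by rewrite [X in _ <= X]mulrA ler_pM2r ?ltr0n // -exprMn.
Qed.

End NeighbourhoodBound.

Lemma ndl_expanding (R : realType) (G : sgraph) (n d r : nat) (lambda : R) :
  ndl_graph n d lambda G -> (1 < r)%N -> 0 < lambda -> r%:R * lambda <= d%:R ->
  expanding (@adj G) r.
Proof.
move=> ndl r_gt1 lam_gt0 le_d X; have [->|X_gt0] := posnP #|X|;
  first by rewrite muln0.
have lam_lt : lambda < d%:R
  by apply: lt_le_trans le_d; rewrite ltr_pMl // ltr1n.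
have [cardG _ _] := ndl.
have n_gt0 : (0 < n)%N by rewrite -cardG (leq_trans X_gt0) // max_card.
have := nb_lower_bound ndl lam_lt n_gt0 X; rewrite -cardG.
rewrite -(ler_nat R) !(natrM, natrD, natrX).
have : 0 < d%:R :> R := lt_trans lam_gt0 lam_lt.
have : 0 < #|X|%:R :> R by rewrite ltr0n.
move: (#|X|%:R : R) (#|G|%:R : R) (#|nb (@adj G) X|%:R : R) (ler0n R #|G|)
  (ler0n R #|nb (@adj G) X|) => k N M N_ge0 M_ge0 k_gt0 d_gt0 bound.
have le_sqr : (r%:R * lambda) ^+ 2 <= d%:R ^+ 2.
  by rewrite lerXn2r ?nnegrE ?mulr_ge0 // ltW.
rewrite -(ler_pM2l (_ : 0 < d%:R ^+ 2 * k));
  last by rewrite mulr_gt0 ?exprn_gt0.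
have := ler_wpM2l (sqr_ge0 r%:R) bound.
have : M * N * k * (r%:R * lambda) ^+ 2 <= M * N * k * d%:R ^+ 2.
  by apply: ler_wpM2l => //; rewrite !mulr_ge0 // ltW.
by lra.
Qed.

Theorem theorem1p5 (R : realType) (Delta : nat) :
  exists2 C : R, 0 < C &
    exists d0 : nat, forall d : nat, (d0 <= d)%N ->
      forall (n : nat) (lambda : R) (G : sgraph),
        ndl_graph n d lambda G -> C <= d%:R / lambda ->
        forall T : sgraph,
          is_tree T -> #|T| = n -> (max_degree T <= Delta)%N ->
          contains_copy (square G) T.
Proof.
pose b := maxn Delta 2; pose r := ratio b.
have b_gt1 : (1 < b)%N by rewrite leq_maxr.
have r_gt1 : (1 < r)%N := ratio_gt1 b_gt1.
have r_gt0 : 0 < r%:R :> R by rewrite ltr0n ltnW.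
exists r%:R => //; exists r => d le_d n lambda G ndl le_r T treeT cardT degT.
have lam_gt0 : 0 < lambda.
  rewrite ltNge; apply/negP => lam_le0; have := lt_le_trans r_gt0 le_r.
  by rewrite ltNge mulr_ge0_le0 // invr_le0.
have [cardG regG _] := ndl; have [[/card_gt0P[u _] _] _] := treeT.
have n_large : (r <= #|G|)%N.
  have /card_gt0P[x _] : (0 < #|G|)%N.
    by rewrite cardG -cardT; apply/card_gt0P; exists u.
  by apply: leq_trans le_d _; rewrite -(regG x); exact: max_card.
apply: (square_contains_tree b_gt1 treeT _ _ n_large).
- by rewrite cardT cardG.
- by apply: leq_trans degT _; rewrite leq_maxl.
- by apply: (ndl_expanding ndl r_gt1 lam_gt0); rewrite -ler_pdivlMr.
Qed.
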